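(* Fix an integer $n\ge1$ and an $n$-core $\delta$. Then $$\prod_{i,j}\prod_{k=0}^{n-1}\left(1+x_iy_jq^{2k}\right)=\sum_{\lambda}q^{(n-1)|\lambda/\tilde\lambda|/n}\;\mathcal{G}_{\lambda'}(X;q)\,\mathcal{G}_\lambda(Y;q^{-1}),$$ where the sum is over all partitions $\lambda$ with $n$-core $\tilde\lambda=\delta$, $\lambda'$ is the conjugate partition, and $|\lambda/\tilde\lambda|$ is the number of squares of $\lambda/\tilde\lambda$ (so $|\lambda/\tilde\lambda|/n$ is the number of ribbons in any ribbon tiling of it).
   Context: $X=(x_1,x_2,\ldots)$ and $Y=(y_1,y_2,\ldots)$ are two sets of variables and the identity is one of formal power series. Ribbons and ribbon functions: fix $n\ge1$. Partitions are identified with their Young diagrams (first row on top); ''connected'' means connected through edges. A ribbon is a connected skew shape with exactly $n$ squares containing no $2\times 2$ square; its spin is its number of rows minus 1. The spin $s(T)$ of a shape tiled by ribbons is the sum of the spins of its ribbons. A horizontal ribbon strip is a skew shape tiled by ribbons such that the topright-most square of every ribbon touches the northern edge of the shape; such a tiling is unique if it exists. A semistandard ribbon tableau $T$ of shape $\lambda/\mu$ is a chain of partitions $\mu=\mu^0\subset\mu^1\subset\cdots\subset\mu^r=\lambda$ with each $\mu^{i}/\mu^{i-1}$ a (possibly empty) horizontal ribbon strip, whose ribbons are labelled $i$; its weight $w(T)$ is the composition whose $i$-th part is the number of ribbons labelled $i$. Put $\mathcal{G}_{\lambda/\mu}(X;q)=\sum_T q^{s(T)}\mathbf{x}^{w(T)}$,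 summed over semistandard ribbon tableaux of shape $\lambda/\mu$. The $n$-core $\tilde\lambda$ of $\lambda$ is the partition obtained by removing $n$-ribbons from $\lambda$ until no longer possible; an $n$-core is a partition equal to its own $n$-core. Put $\mathcal{G}_\lambda:=\mathcal{G}_{\lambda/\tilde\lambda}$. *)

(* Defs.v *)
From HB Require Import structures.
From mathcomp Require Import all_boot all_order all_algebra finmap.
From mathcomp Require Import boolp classical_sets cardinality fsbigop.
From mathcomp.multinomials Require Import monalg.

Set Implicit Arguments.
Unset Strict Implicit.
Unset Printing Implicit Defensive.

Import GRing.Theory.

Local Open Scope nat_scope.
Local Open Scope fset_scope.

Definition is_part (s : seq nat) : bool := sorted geq s && (0 \notin s).

Record intpart : Type := Intpart {
  parts :> seq nat;
  partsP : is_part parts }.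

HB.instance Definition _ := [isSub for parts].
HB.instance Definition _ := [Countable of intpart by <:].

Definition conj_seq (s : seq nat) : seq nat :=
  mkseq (fun c => count (fun x => c < x) s) (head 0 s).

Lemma conj_seq_part (s : seq nat) : is_part (conj_seq s).
Proof.
apply/andP; split.
  rewrite /conj_seq /mkseq.
  apply: (homo_sorted (e := leq)); last exact: iota_sorted.
  move=> i j le_ij; apply: sub_count => x; exact: leq_ltn_trans.
apply/negP => /mapP [c]; rewrite mem_iota add0n => /andP [_].
by case: s => [|a s] //= ->.
Qed.

Definition conj_part (la : intpart) : intpart :=
  Intpart (conj_seq_part la).

(* A square is a pair (row, column), both counted from 0, rows going down. *)

Notation square := (nat * nat)%type.

Definition diagram (la : intpart) : {fset square} :=
  [fset u in [seq (r, c) | r <- iota 0 (size la), c <- iota 0 (nth 0 la r)]].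

Definition part_sub (mu la : intpart) : bool := diagram mu `<=` diagram la.

Definition skew_diagram (la mu : intpart) : {fset square} :=
  diagram la `\` diagram mu.

Definition is_skew_shape (S : {fset square}) : Prop :=
  exists la mu : intpart, part_sub mu la /\ S = skew_diagram la mu.

Definition edge_adjacent (u v : square) : bool :=
  ((u.1 == v.1) && ((u.2 == v.2.+1) || (v.2 == u.2.+1))) ||
  ((u.2 == v.2) && ((u.1 == v.1.+1) || (v.1 == u.1.+1))).

Definition edge_connected (S : {fset square}) : Prop :=
  forall u v : S, connect (fun a b : S => edge_adjacent (val a) (val b)) u v.

Definition contains_2x2 (S : {fset square}) : Prop :=
  exists r c, [/\ (r, c) \in S, (r, c.+1) \in S,
                  (r.+1, c) \in S & (r.+1, c.+1) \in S].

Definition is_ribbon (n : nat) (R : {fset square}) : Prop :=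
  [/\ is_skew_shape R, edge_connected R, #|` R| = n & ~ contains_2x2 R].

Definition spin (R : {fset square}) : nat := #|` [fset u.1 | u in R] |.-1.

Definition is_topright (R : {fset square}) (u : square) : Prop :=
  u \in R /\ forall v, v \in R -> u.1 <= v.1 /\ v.2 <= u.2.

(* For a square u of the skew shape S, its upper side lies on the northern edge
   of S when u is in row 0 or the square just above u is not in S. *)
Definition on_northern_edge (S : {fset square}) (u : square) : Prop :=
  forall r, u.1 = r.+1 -> (r, u.2) \notin S.

Definition is_strip_tiling (n : nat) (S : {fset square})
    (P : {fset {fset square}}) : Prop :=
  [/\ fcover P = S, trivIfset P &
      forall R, R \in P ->
        is_ribbon n R /\ exists2 u, is_topright R u & on_northern_edge S u].

Definition is_horizontal_strip (n : nat) (la mu : intpart) : Prop :=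
  part_sub mu la /\ exists P, is_strip_tiling n (skew_diagram la mu) P.

(* The tiling is unique when it exists. *)
Definition strip_ribbons (n : nat) (la mu : intpart) :
    {fset {fset square}} :=
  xget fset0 [set P | is_strip_tiling n (skew_diagram la mu) P]%classic.

(*  The chain mu^0, mu^1, ..., mu^r is stored as mu := mu^0 and
    c := [:: mu^1; ...; mu^r].  Chains that differ only by final empty strips
    are the same tableau (they carry the same labelled ribbons), so we keep the
    representative with mu^(r-1) <> mu^r.  Labels are counted from 0: the
    ribbons of mu^(i+1)/mu^i correspond to the variable of index i. *)

Definition chain_nth (mu : intpart) (c : seq intpart) (i : nat) :
    intpart := nth (last mu c) (mu :: c) i.

Definition is_ribbon_tableau (n : nat) (la mu : intpart)
    (c : seq intpart) : Prop :=
  [/\ forall i, i < size c ->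
        is_horizontal_strip n (chain_nth mu c i.+1) (chain_nth mu c i),
      last mu c = la &
      c != [::] -> chain_nth mu c (size c).-1 != la].

Definition tableau_ribbons (n : nat) (mu : intpart) (c : seq intpart)
    (i : nat) : {fset {fset square}} :=
  strip_ribbons n (chain_nth mu c i.+1) (chain_nth mu c i).

Definition tableau_spin (n : nat) (mu : intpart) (c : seq intpart) : nat :=
  \sum_(i < size c) \sum_(R <- tableau_ribbons n mu c i) spin R.

Definition has_weight (n : nat) (mu : intpart) (c : seq intpart)
    (a : {cmonom nat}) : Prop :=
  forall i, #|` tableau_ribbons n mu c i| = a i.

Definition removes_ribbon (n : nat) (la mu : intpart) : Prop :=
  part_sub mu la /\ is_ribbon n (skew_diagram la mu).

Inductive removes_ribbons (n : nat) : intpart -> intpart -> Prop :=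
| removes_none la : removes_ribbons n la la
| removes_step la mu nu :
    removes_ribbon n la mu -> removes_ribbons n mu nu ->
    removes_ribbons n la nu.

(* For n >= 1 the result of removing n-ribbons until no longer possible exists
   and does not depend on the ribbons that are chosen. *)
Definition ncore (n : nat) (la : intpart) : intpart :=
  xget la [set de | removes_ribbons n la de /\
                    forall mu, ~ removes_ribbon n de mu]%classic.

Definition is_ncore (n : nat) (de : intpart) : Prop := ncore n de = de.

(*  A monomial in x_0, x_1, ... is an element of {cmonom nat}.  A power series
    in X is its coefficient function, and a power series in X and Y is the
    function sending a, b to the coefficient of x^a y^b. *)

Section Series.
Variable R : comNzRingType.

Definition series : Type := {cmonom nat} -> R.
Definition series2 : Type := {cmonom nat} -> {cmonom nat} -> R.

Local Open Scope ring_scope.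

Definition ribbon_function (n : nat) (q : R) (la mu : intpart) : series :=
  fun a => \sum_(c \in [set c | is_ribbon_tableau n la mu c /\
                                has_weight n mu c a]%classic)
             q ^+ tableau_spin n mu c.

Definition ribbon_functionG (n : nat) (q : R) (la : intpart) : series :=
  ribbon_function n q la (ncore n la).

Definition series_XY (F G : series) : series2 := fun a b => F a * G b.

Local Notation polyXY := {malg {malg R[{cmonom nat}]}[{cmonom nat}]}.

Definition coefXY (p : polyXY) : series2 := fun a b => (p@_b)@_a.

Definition termXY (z : R) (i j : nat) : polyXY :=
  << << z *g ucm i >> *g ucm j >>.

(* Coefficientwise (unordered) convergence: each coefficient of the finite
   partial products, resp. sums, is eventually constant along the directed set
   of finite sets of indices. *)
Definition is_series_prod (I : choiceType) (F : I -> polyXY) (P : series2) :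
    Prop :=
  forall a b, exists A : {fset I}, forall B : {fset I}, A `<=` B ->
    coefXY (\prod_(i <- B) F i) a b = P a b.

Definition is_series_sum (I : choiceType) (D : pred I) (F : I -> series2)
    (P : series2) : Prop :=
  forall a b, exists A : {fset I}, forall B : {fset I}, A `<=` B ->
    \sum_(i <- B | D i) F i a b = P a b.

End Series.

(* Main.v *)
(* Encode a partition by its Maya diagram: adding an n-ribbon moves a bead from
   some position i to the hole i+n, and the spin is the number of beads jumped
   over. A horizontal ribbon strip is a sequence of such moves with increasing i;
   by conjugation a vertical one is a sequence with decreasing i. Let u_i and d_i
   add and remove a ribbon at i with weight p^spin. Then u_i and d_j commute for
   i <> j, and if N_i is the number of beads in [i, i+n) and
     K_i = prod_(k < N_i) (1 + z w p^(2k)),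
   then (1 + w d_i) (1 + z u_i) K_(i+1) = K_i (1 + z u_i) (1 + w d_i).
   Multiplying over all i telescopes, because K_i is 1 on the far right and the
   full product over k < n on the far left: adding a vertical strip commutes with
   removing a horizontal one up to the factor prod_(k < n) (1 + z w p^(2k)).
   Nothing can be removed from a core, so moving all removals past all additions
   evaluates the sum over partitions. For p = q^-1, z = q^(n-1) x and
   w = q^(n-1) y the factor is prod_(k < n) (1 + x y q^(2k)). *)

Require Import Defs.
From mathcomp Require Import all_boot all_order all_algebra finmap.
From mathcomp.multinomials Require Import monalg.
From mathcomp Require Import zify ring.
From mathcomp Require Import boolp classical_sets functions cardinality fsbigop.

Set Implicit Arguments.
Unset Strict Implicit.
Unset Printing Implicit Defensive.

Import Order.TTheory GRing.Theory Num.Theory.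

Local Open Scope ring_scope.

(** * Diagonal profiles of partitions *)

(** Origin of K_i: where position i is active, the operators act on the span of two configurations,
    a bead at i or a bead at i+n, with the same b beads strictly between. There (1 + w d_i) (1 + z
    u_i) and (1 + z u_i) (1 + w d_i) differ only in which of the two gets the extra diagonal term z
    w p^(2b). The windows [i, i+n) and [i+1, i+n+1) hold b+1 and b beads in the first configuration,
    b and b+1 in the second, so a product over the beads of a window changes by exactly the factor 1
    + z w p^(2b). The two scalings serve different ends: q^(n-1) on x turns the spin of a vertical
    strip into that of its conjugate, q^(n-1) on y produces the prefactor of the sum. Finiteness
    shapes the rest. A given coefficient involves finitely many variables, and the operators
    truncated to an interval of positions satisfy the identity exactly once the interval exceeds the
    core by n per variable on either side, and by one more window on the left. The partitions that
    contribute to a given coefficient have a fixed size, so a finite box contains them all. *)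

Lemma lt_count_iota (P : pred nat) N r : (forall i, P i.+1 -> P i) ->
  (r < count P (iota 0 N))%N = (r < N)%N && P r.
Proof.
move=> Pdown.
have PdownD i j : (i <= j)%N -> P j -> P i.
  by move=> /subnK<-; elim: (j - i)%N => //= d IH /Pdown.
elim: N => [|N IH] in r *; first by rewrite ltn0.
rewrite -(addn1 N) iotaD count_cat /= add0n addn0.
have countN : P N -> count P (iota 0 N) = N.
  move=> PN; rewrite -[RHS](size_iota 0); apply/eqP; rewrite -all_count.
  by apply/allP => i; rewrite mem_iota => /andP[_ /ltnW ltiN]; exact: PdownD PN.
case PN: (P N) => /=.
  rewrite countN // addn1 andb_idr //; rewrite ltnS => ler; exact: PdownD PN.
rewrite addn0 IH addn1 ltnS (leq_eqVlt r N).
by case: eqVneq => [->|]; rewrite ?ltnn ?PN.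
Qed.

Lemma part_nonincr (la : intpart) i j : (i <= j)%N -> (nth 0%N la j <= nth 0%N la i)%N.
Proof.
move=> leij; have [lt_j|le_j] := ltnP j (size la); last by rewrite (nth_default _ le_j).
have /andP[srt _] := partsP la.
rewrite leq_eqVlt in leij; case/orP: leij => [/eqP->//|ltij].
apply: (sorted_ltn_nth (leT := geq)) => //; last exact: ltn_trans lt_j.
by move=> x y z /= h1 h2; exact: leq_trans h2 h1.
Qed.

Lemma part_nth_gt0 (la : intpart) i : (i < size la)%N -> (0 < nth 0%N la i)%N.
Proof.
move=> lti; rewrite lt0n; apply: contraL (partsP la) => /eqP e0.
by rewrite /is_part -e0 mem_nth // andbF.
Qed.

Lemma part_eq (la mu : intpart) : (forall i, nth 0%N la i = nth 0%N mu i) -> la = mu.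
Proof.
move=> eq_nth; apply: val_inj; apply: (@eq_from_nth _ 0%N) => [|i _]; last exact: eq_nth.
have aux (al be : intpart) : (forall i, nth 0%N al i = nth 0%N be i) -> (size al <= size be)%N.
  move=> e; rewrite leqNgt; apply/negP => lt_.
  by have := part_nth_gt0 lt_; rewrite e nth_default.
by apply/eqP; rewrite eqn_leq !aux.
Qed.

Lemma mem_diagram (la : intpart) (u : square) :
  (u \in diagram la) = (u.2 < nth 0%N la u.1)%N.
Proof.
rewrite /diagram in_fset /=; apply/idP/idP.
  by case/allpairsPdep => r [c [_ + ->]] /=; rewrite mem_iota.
move=> ltu; apply/allpairsPdep; exists u.1, u.2; split; rewrite ?mem_iota //.
  rewrite /= add0n ltnNge; apply/negP => h; by rewrite nth_default in ltu.
by case: u {ltu}.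
Qed.

(* The profile of a partition along diagonals: [rho la k] rows of [la] reach
   strictly beyond the diagonal of content [k] (content = column - row). It
   also counts the beads of the Maya diagram of [la] at positions >= [k]. *)
Definition rho (la : intpart) (k : int) : nat :=
  count (fun r : nat => k + r%:Z < (nth 0%N la r)%:Z) (iota 0 (size la + (absz k))).

(** The range in [rho] is long enough: a row r below the diagram has length 0, so it is counted only
    if k + r < 0, which forces r < |k|. *)
Lemma lt_rho la (k : int) (r : nat) : (r < rho la k)%N = (k + r%:Z < (nth 0%N la r)%:Z).
Proof.
rewrite /rho lt_count_iota; last first.
  by move=> i; have := @part_nonincr la i i.+1 (leqnSn i); lia.
apply: andb_idl => h; rewrite ltnNge; apply/negP => h2.
by rewrite nth_default in h; lia.
Qed.

Definition cont (u : square) : int := u.2%:Z - u.1%:Z.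

Lemma mem_diagram_rho la u : (u \in diagram la) = (u.1 < rho la (cont u))%N.
Proof. by rewrite mem_diagram lt_rho /cont subrK ltz_nat. Qed.

Lemma rho_step la (k : int) : (rho la (k + 1)%R <= rho la k <= (rho la (k + 1)%R).+1)%N.
Proof.
apply/andP; split; rewrite leqNgt; apply/negP.
  by rewrite lt_rho; have := ltnn (rho la k); rewrite lt_rho; lia.
rewrite lt_rho => h.
have := ltnn (rho la (k + 1)); rewrite lt_rho.
have := @part_nonincr la _ _ (leqnSn (rho la (k + 1))); lia.
Qed.

Lemma rhoDl la (k : int) (d : nat) :
  (rho la (k + d%:Z)%R <= rho la k <= rho la (k + d%:Z)%R + d)%N.
Proof.
elim: d => [|d IH]; first by rewrite addr0 addn0 leqnn.
have -> : k + d.+1%:Z = k + d%:Z + 1 by lia.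
have := rho_step la (k + d%:Z); lia.
Qed.

Lemma rho_mono la (k l : int) : k <= l -> (rho la l <= rho la k)%N /\ (rho la k)%:Z <= (rho la l)%:Z + (l - k).
Proof.
move=> le_kl; have := rhoDl la k (absz (l - k)).
have -> : k + (absz (l - k)) = l by lia.
lia.
Qed.

(** For k < 0 the diagonal meets the first -k rows left of column 0, and all of them are counted,
    even empty ones. This is the sea of beads on the far left. *)
Lemma rho_ge la (k : int) : - k <= (rho la k)%:Z.
Proof.
case: k => [k|k]; first lia.
have : (k < rho la (Negz k))%N by rewrite lt_rho; lia.
lia.
Qed.

Lemma rho_big (la : intpart) (k : int) : (head 0%N la)%:Z <= k -> rho la k = 0%N.
Proof.
move=> h; apply/eqP; rewrite -leqn0 leqNgt lt_rho nth0; lia.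
Qed.

Lemma rho_small (la : intpart) (k : int) : k <= - (size la)%:Z -> (rho la k)%:Z = - k.
Proof.
move=> h; have := rho_ge la k; have := lt_rho la k (absz k).
by rewrite (@nth_default _ 0%N la); lia.
Qed.

Lemma rho_inj la mu : (forall k, rho la k = rho mu k) -> la = mu.
Proof.
move=> e; apply: part_eq => r.
have aux c : (c < nth 0%N la r)%N = (c < nth 0%N mu r)%N.
  by rewrite -[LHS](mem_diagram la (r, c)) -[RHS](mem_diagram mu (r, c)) !mem_diagram_rho e.
apply/eqP; rewrite eqn_leq; apply/andP; split; rewrite leqNgt; apply/negP.
  by rewrite aux ltnn.
by rewrite -aux ltnn.
Qed.

Lemma part_subP mu la : reflect (forall k, (rho mu k <= rho la k)%N) (part_sub mu la).
Proof.
apply: (iffP (@fsubsetP _ (diagram mu) (diagram la))) => [h k | h u].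
  rewrite leqNgt; apply/negP => lt_k.
  have := rho_ge la k => ge_k.
  have := h (rho la k, absz (k + (rho la k)%:Z)); rewrite !mem_diagram_rho /cont /=.
  have -> : (absz (k + (rho la k)%:Z))%:Z - (rho la k)%:Z = k by lia.
  rewrite lt_k ltnn; by move=> /(_ isT).
rewrite !mem_diagram_rho; have := h (cont u); lia.
Qed.

(** The source of all partitions built from bead configurations. Row r consists of the columns c
    with r < g (c - r); unit steps make this an initial segment and the row lengths
    nonincreasing. *)
Lemma part_of_rho (g : int -> nat) (M : nat) :
  (forall k : int, (g (k + 1)%R <= g k <= (g (k + 1)%R).+1)%N) ->
  (forall k : int, M%:Z <= k -> g k = 0%N) -> (forall k : int, k <= - M%:Z -> (g k)%:Z = - k) ->
  exists la, forall k, rho la k = g k.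
Proof.
move=> gstep gbig gsmall.
have gD (k : int) (d : nat) : (g (k + d%:Z)%R <= g k <= g (k + d%:Z)%R + d)%N.
  elim: d => [|d IH]; first by rewrite addr0 addn0 leqnn.
  have -> : k + d.+1%:Z = k + d%:Z + 1 by lia.
  have := gstep (k + d%:Z); lia.
pose P (r c : nat) := (r < g (c%:Z - r%:Z)%R)%N.
pose row r := count (P r) (iota 0 (M + r)).
have rowE r c : (c < row r)%N = P r c.
  rewrite /row lt_count_iota; last first.
    move=> i; rewrite /P; have := gstep (i%:Z - r%:Z).
    have -> : i%:Z - r%:Z + 1 = i.+1%:Z - r%:Z by lia.
    lia.
  apply: andb_idl => h; rewrite ltnNge; apply/negP => h2.
  by move: h; rewrite /P (gbig _); lia.
have row_noninc r : (row r.+1 <= row r)%N.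
  rewrite leqNgt rowE; have := ltnn (row r.+1); rewrite rowE /P.
  have := gstep ((row r)%:Z - r.+1%:Z).
  have -> : (row r)%:Z - r.+1%:Z + 1 = (row r)%:Z - r%:Z by lia.
  have := ltnn (row r); rewrite rowE /P; lia.
have row0 r : (M <= r)%N -> row r = 0%N.
  move=> leM; apply/eqP; rewrite -leqn0 leqNgt rowE /P.
  by have := gsmall (0%:Z - r%:Z); lia.
(* [is_part] forbids zero parts; in a sorted sequence they all stand at the end, so dropping them
   does not change [nth 0]. *)
pose s := [seq x <- mkseq row M | x != 0%N].
have srt : sorted geq (mkseq row M).
  apply: (homo_sorted (e := leq)); last exact: iota_sorted.
  move=> i j /subnK<-; elim: (j - i)%N => //= d IH; exact: leq_trans (row_noninc _) IH.
have nth_s (t : seq nat) r : sorted geq t -> nth 0%N [seq x <- t | x != 0%N] r = nth 0%N t r.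
  elim: t r => [|x t IH] r //= pt.
  case: eqVneq => [x0|xn0] /=; last by case: r => [|r] //=; rewrite IH ?(path_sorted pt).
  have t0 : all (fun y => y == 0%N) t.
    have := order_path_min (leT := geq) _ pt.
    rewrite x0 => /(_ (fun x y z h1 h2 => leq_trans h2 h1)) /allP h.
    by apply/allP => y /h /=; rewrite leqn0.
  have -> : [seq x <- t | x != 0%N] = [::].
    rewrite (eq_in_filter (a2 := pred0)) ?filter_pred0 // => y /(allP t0) ->.
    by [].
  rewrite nth_nil x0; case: r => [|r] //=.
  have [lt_r|le_r] := ltnP r (size t); last by rewrite nth_default.
  by have /eqP-> := allP t0 _ (mem_nth 0%N lt_r).
have s_part : is_part s.
  rewrite /is_part mem_filter eqxx /= andbT.
  apply: sorted_filter => // x y z h1 h2; exact: leq_trans h2 h1.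
exists (Intpart s_part) => k.
have nthE r : nth 0%N (Intpart s_part) r = row r.
  rewrite /= nth_s //; have [lt_r|le_r] := ltnP r M; first by rewrite nth_mkseq.
  by rewrite nth_default ?size_mkseq // row0.
have g_ge (i : int) : - i <= (g i)%:Z.
  have [|h] := lerP i (- M%:Z); first by move=> /gsmall->.
  have := gsmall (- M%:Z) (lexx _).
  have := gD (- M%:Z) (absz (i + M%:Z)).
  have -> : - M%:Z + (absz (i + M%:Z)) = i by lia.
  lia.
suff eq_lt r : (r < rho (Intpart s_part) k)%N = (r < g k)%N.
  apply/eqP; rewrite eqn_leq; apply/andP; split; rewrite leqNgt; apply/negP.
    by rewrite eq_lt ltnn.
  by rewrite -eq_lt ltnn.
rewrite lt_rho nthE; have [h|h] := ltrP (k + r%:Z) 0.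
  by have := g_ge k; lia.
have -> : k + r%:Z = (absz (k + r%:Z))%:Z by lia.
rewrite ltz_nat rowE /P.
by have -> : (absz (k + r%:Z))%:Z - r%:Z = k by lia.
Qed.

Lemma nth_conj_seq (s : seq nat) c : sorted geq s ->
  nth 0%N (conj_seq s) c = count (fun x => c < x)%N s.
Proof.
move=> srt; rewrite /conj_seq.
have [lt_c|le_c] := ltnP c (head 0%N s); first by rewrite nth_mkseq.
rewrite nth_default ?size_mkseq //; apply/esym/eqP; rewrite -leqn0 leqNgt -has_count.
apply/hasPn => x xs; rewrite -leqNgt; apply: leq_trans le_c.
case: s srt xs => [|y s] //= pt; rewrite inE => /predU1P[->//|].
have := order_path_min (leT := geq) _ pt.
move=> /(_ (fun x y z h1 h2 => leq_trans h2 h1)) /allP h; exact: h.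
Qed.

Lemma mem_diagram_conj la r c : ((r, c) \in diagram (conj_part la)) = ((c, r) \in diagram la).
Proof.
have /andP[srt _] := partsP la.
rewrite !mem_diagram /= nth_conj_seq //.
have -> : count (fun x => r < x)%N la =
    count (fun i => r < nth 0%N la i)%N (iota 0 (size la)).
  rewrite -[in LHS](mkseq_nth 0%N la) count_map; exact: eq_count.
rewrite lt_count_iota; last first.
  by move=> i; have := @part_nonincr la i i.+1 (leqnSn i); lia.
apply: andb_idl => h; rewrite ltnNge; apply/negP => h2; by rewrite nth_default in h.
Qed.

(** Transposition sends diagonal k to diagonal -k; the correction is the difference between row and
    column index along a diagonal. *)
Lemma rho_conj la (k : int) : (rho (conj_part la) k)%:Z = (rho la (- k))%:Z - k.
Proof.
have ge1 := rho_ge la (- k); have ge2 := rho_ge (conj_part la) k.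
pose R := absz ((rho la (- k))%:Z - k).
suff -> : rho (conj_part la) k = R by rewrite /R; lia.
suff eq_lt r : (r < rho (conj_part la) k)%N = (r < R)%N.
  apply/eqP; rewrite eqn_leq; apply/andP; split; rewrite leqNgt; apply/negP.
    by rewrite eq_lt ltnn.
  by rewrite -eq_lt ltnn.
have [h|h] := ltrP (k + r%:Z) 0; first by rewrite /R; lia.
have := mem_diagram_conj la r (absz (k + r%:Z)); rewrite !mem_diagram_rho /cont /=.
have -> : (absz (k + r%:Z))%:Z - r%:Z = k by lia.
have -> : r%:Z - (absz (k + r%:Z))%:Z = - k by lia.
rewrite /R; lia.
Qed.

Lemma conj_partK : involutive conj_part.
Proof.
move=> la; apply: rho_inj => k.
by have := rho_conj (conj_part la) k; have := rho_conj la (- k); rewrite opprK; lia.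
Qed.

(** * Ribbons as bead moves *)

Definition bead (la : intpart) (k : int) : bool := rho la k != rho la (k + 1).

Lemma mem_skew mu nu (u : square) :
  (u \in skew_diagram nu mu) = (rho mu (cont u) <= u.1 < rho nu (cont u))%N.
Proof. by rewrite /skew_diagram in_fsetD !mem_diagram_rho -leqNgt. Qed.

(** The column is right only when k + r >= 0, a condition that [rho_ge] supplies wherever r is at
    least [rho mu k]. *)
Definition sq (r : nat) (k : int) : square := (r, absz (k + r%:Z)).

Lemma cont_sq r k : - r%:Z <= k -> cont (sq r k) = k.
Proof. by rewrite /cont /sq /=; lia. Qed.

Lemma sq_cont u : sq u.1 (cont u) = u.
Proof. by case: u => r c; rewrite /sq /cont /=; congr pair; lia. Qed.

Lemma sq_inj (u v : square) : cont u = cont v -> u.1 = v.1 -> u = v.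
Proof. by move=> h1 h2; rewrite -(sq_cont u) h1 h2 sq_cont. Qed.

Lemma mem_skew_sq mu nu r (k : int) : (rho mu k <= r)%N ->
  (sq r k \in skew_diagram nu mu) = (r < rho nu k)%N.
Proof. by move=> h; rewrite mem_skew cont_sq ?h //; have := rho_ge mu k; lia. Qed.

Lemma int_min (s : seq int) x : x \in s -> exists2 m, m \in s & forall y, y \in s -> m <= y.
Proof.
elim: s x => [|a s IH] x //= _; case: s IH => [|b s] IH.
  by exists a; rewrite ?mem_head // => y; rewrite inE => /eqP->.
have [m ms mmin] := IH b (mem_head _ _).
exists (if a <= m then a else m).
  by case: ifP => _; rewrite inE ?eqxx // ms orbT.
move=> y; rewrite inE => /predU1P[->|/mmin]; case: ifP => //; lia.
Qed.

Definition int_range (m : int) (j : nat) : {fset int} :=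
  [fset x in [seq (m + l%:Z)%R | l <- iota 0 j]]%fset.

Lemma card_int_range (m : int) j : #|` int_range m j| = j.
Proof.
rewrite /int_range card_fseq undup_id ?size_map ?size_iota // map_inj_uniq ?iota_uniq //.
by move=> a b; lia.
Qed.

Lemma mem_int_range (m : int) j x :
  (x \in int_range m j) = (m <= x < m + j%:Z).
Proof.
rewrite /int_range in_fset /=; apply/mapP/idP => [[l]|h].
  by rewrite mem_iota => h ->; lia.
by exists (absz (x - m)); rewrite ?mem_iota; lia.
Qed.

Lemma edge_adjacent_cont u v : edge_adjacent u v -> cont v = cont u + 1 \/ cont v = cont u - 1.
Proof. by case: u v => [r c] [r' c']; rewrite /edge_adjacent /cont /=; lia. Qed.

Lemma toprightI (R : {fset square}) (u : square) : u \in R ->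
  (forall v : square, v \in R -> (u.1 <= v.1)%N /\ (v.2 <= u.2)%N) -> is_topright R u.
Proof. by []. Qed.

Lemma topright_uniq R u v : is_topright R u -> is_topright R v -> u = v.
Proof.
case=> uR umax [vR vmax]; have [h1 h2] := umax _ vR; have [h3 h4] := vmax _ uR.
by case: u v h1 h2 h3 h4 {uR umax vR vmax} => r c [r' c'] /= *; congr pair; lia.
Qed.

Lemma rho_ivt la (k : int) (d r : nat) : (rho la (k + d%:Z)%R <= r <= rho la k)%N ->
  exists2 j, (j <= d)%N & rho la (k + j%:Z) = r.
Proof.
elim: d => [|d IH] h; first by exists 0%N => //; move: h; rewrite addr0; lia.
have [e|ne] := eqVneq (rho la (k + d.+1%:Z)) r; first by exists d.+1.
have [] := IH _; last by move=> j lej <-; exists j; rewrite // ltnW.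
have := rho_step la (k + d%:Z).
have -> : k + d%:Z + 1 = k + d.+1%:Z by lia.
lia.
Qed.

Section Ribbons.
Variable n : nat.
Hypothesis n_gt0 : (0 < n)%N.

(* [nu] is obtained from [mu] by adding a ribbon whose squares have contents
   i+1, ..., i+n; on the Maya diagram a bead jumps from i to i+n. *)
Definition addrib (i : int) (mu nu : intpart) : Prop :=
  forall k : int, rho nu k = (rho mu k + (i < k <= i + n%:Z)%R)%N.

Definition canadd (mu : intpart) (i : int) := bead mu i && ~~ bead mu (i + n%:Z).
Definition canrem (nu : intpart) (i : int) := ~~ bead nu i && bead nu (i + n%:Z).

Lemma addrib_canadd i mu nu : addrib i mu nu -> canadd mu i.
Proof.
move=> h; rewrite /canadd /bead.
have := h i; have := h (i + 1); have := h (i + n%:Z); have := h (i + n%:Z + 1).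
have := rho_step mu i; have := rho_step nu i.
have := rho_step mu (i + n%:Z); have := rho_step nu (i + n%:Z); lia.
Qed.

Lemma addrib_canrem i mu nu : addrib i mu nu -> canrem nu i.
Proof.
move=> h; rewrite /canrem /bead.
have := h i; have := h (i + 1); have := h (i + n%:Z); have := h (i + n%:Z + 1).
have := rho_step mu i; have := rho_step nu i.
have := rho_step mu (i + n%:Z); have := rho_step nu (i + n%:Z); lia.
Qed.

(** Raising the profile by 1 on (i, i+n] can violate the unit-step condition only at the two ends,
    where it asks for a bead at i and a hole at i+n. *)
Lemma canadd_addrib i mu : canadd mu i -> exists nu, addrib i mu nu.
Proof.
rewrite /canadd /bead => can.
apply: (part_of_rho (M := size mu + head 0%N mu + absz i + n.+1)) => k.
- have := rho_step mu k.
  have := rho_step mu i; have := rho_step mu (i + n%:Z).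
  have [->|] := eqVneq k i; first by move: can; lia.
  have [->|] := eqVneq k (i + n%:Z); first by move: can; lia.
  lia.
- by move=> hk; rewrite rho_big; lia.
- by move=> hk; have := rho_small (la := mu) (k := k); lia.
Qed.

Lemma canrem_addrib i nu : canrem nu i -> exists mu, addrib i mu nu.
Proof.
rewrite /canrem /bead => can.
(* Subtraction in [nat] truncates; the bead of [nu] at i+n keeps the profile positive on the whole
   interval. *)
have pos k : i < k <= i + n%:Z -> (0 < rho nu k)%N.
  move=> hk; have [h _] : (rho nu (i + n%:Z) <= rho nu k)%N /\ (rho nu k)%:Z <= (rho nu (i + n%:Z))%:Z + (i + n%:Z - k).
    by apply: rho_mono; lia.
  by have := rho_step nu (i + n%:Z); lia.
have [mu muE] : exists mu, forall k, rho mu k = (rho nu k - (i < k <= i + n%:Z)%R)%N.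
  apply: (part_of_rho (M := size nu + head 0%N nu + absz i + n.+1)) => k.
  - have := rho_step nu k.
    have := rho_step nu i; have := rho_step nu (i + n%:Z).
    have [->|] := eqVneq k i; first by move: can; lia.
    have [->|] := eqVneq k (i + n%:Z); first by move: can; lia.
    by have := pos k; have := pos (k + 1); lia.
  - by move=> hk; rewrite rho_big; lia.
  - by move=> hk; have := rho_small (la := nu) (k := k); lia.
by exists mu => k; rewrite muE; have := pos k; lia.
Qed.

Lemma addrib_injr i mu nu nu' : addrib i mu nu -> addrib i mu nu' -> nu = nu'.
Proof. by move=> h h'; apply: rho_inj => k; rewrite h h'. Qed.

Lemma addrib_injl i mu mu' nu : addrib i mu nu -> addrib i mu' nu -> mu = mu'.
Proof. by move=> h h'; apply: rho_inj => k; have := h k; rewrite h'; lia. Qed.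

Lemma addrib_sub i mu nu : addrib i mu nu -> part_sub mu nu.
Proof. by move=> h; apply/part_subP => k; rewrite h leq_addr. Qed.

(* The number of beads strictly between i and i+n, since rho counts beads. *)
Definition nbeads (mu : intpart) (i : int) : nat :=
  (rho mu (i + 1) - rho mu (i + n%:Z))%N.

Lemma addrib_nbeads i mu nu : addrib i mu nu -> nbeads nu i = nbeads mu i.
Proof. by move=> h; rewrite /nbeads !h; lia. Qed.

Lemma mem_addrib i mu nu : addrib i mu nu -> forall u : square,
  (u \in skew_diagram nu mu) = (i < cont u <= i + n%:Z) && (u.1 == rho mu (cont u)).
Proof. by move=> h u; rewrite mem_skew h; lia. Qed.

Lemma skew_addrib mu nu i : part_sub mu nu ->
  {in skew_diagram nu mu &, injective cont} ->
  (forall k, i < k <= i + n%:Z <-> exists2 u, u \in skew_diagram nu mu & cont u = k) ->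
  addrib i mu nu.
Proof.
move=> /part_subP sub inj ex k; have := sub k.
have ge := rho_ge mu k.
have le1 : (rho nu k <= (rho mu k).+1)%N.
  rewrite leqNgt; apply/negP => h.
  have := inj (sq (rho mu k) k) (sq (rho mu k).+1 k).
  rewrite !mem_skew_sq ?leqnSn // !cont_sq; [|lia..].
  have -> : (rho mu k < rho nu k)%N by lia.
  by move=> /(_ isT h erefl) [] /eqP; rewrite -[_ == _]/(_ == _.+1)%N; lia.
case: (boolP (i < k <= i + n%:Z)) => [/ex[u]|/negP nk].
  by rewrite mem_skew => + ck; rewrite ck; lia.
suff : ~~ (rho mu k < rho nu k)%N by lia.
apply/negP => h; apply: nk; apply/ex; exists (sq (rho mu k) k); last by rewrite cont_sq //; lia.
by rewrite mem_skew_sq.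
Qed.

(** Start from the minimum m: if m + j with j < n were missing, convexity would confine [C] to the j
    integers from m on. *)
Lemma convex_interval (C : {fset int}) : #|` C| = n ->
  (forall x y z : int, x \in C -> y \in C -> x <= z <= y -> z \in C) ->
  exists i, forall k, (k \in C) = (i < k <= i + n%:Z).
Proof.
move=> cardC convC.
have [x xC] : exists x, x \in C by apply/fset0Pn; rewrite -cardfs_gt0 cardC.
have [m mC mmin] : exists2 m, m \in C & forall y, y \in C -> m <= y.
  exact: (int_min (s := enum_fset C) xC).
have inC j : (j < n)%N -> m + j%:Z \in C.
  move=> ltj; apply: contraT => njC.
  suff /fsubset_leq_card : (C `<=` int_range m j)%fset.
    by rewrite cardC card_int_range; lia.
  apply/fsubsetP => y yC; rewrite mem_int_range mmin //=.
  rewrite ltNge; apply/negP => h; case/negP: njC; apply: (convC m y) => //; lia.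
exists (m - 1) => k.
suff -> : C = int_range m n.
  by rewrite mem_int_range; lia.
apply/esym/eqP; rewrite eqEfcard card_int_range cardC leqnn andbT.
apply/fsubsetP => y; rewrite mem_int_range => h.
have -> : y = m + (absz (y - m))%:Z by lia.
by apply: inC; lia.
Qed.

(** Two squares on one diagonal would span a 2x2 block, so contents are distinct. They form an
    interval because adjacent squares have contents differing by 1: a missing content would
    disconnect the shape. *)
Lemma ribbon_addrib R : is_ribbon n R ->
  exists i mu nu, addrib i mu nu /\ R = skew_diagram nu mu.
Proof.
case=> -[nu [mu [sub ->]]] conn cardR no22.
have inj : {in skew_diagram nu mu &, injective cont}.
  suff aux (u v : square) : u \in skew_diagram nu mu -> v \in skew_diagram nu mu ->
      cont u = cont v -> ~ (u.1 < v.1)%N.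
    move=> u v uR vR cuv; apply: sq_inj => //.
    by have := aux u v uR vR cuv; have := aux v u vR uR (esym cuv); lia.
  rewrite !mem_skew => hu hv cuv lt_uv; apply: no22; exists u.1, u.2.
  have mem r c : (r, c) \in skew_diagram nu mu =
      (rho mu (c%:Z - r%:Z) <= r < rho nu (c%:Z - r%:Z))%N by rewrite mem_skew.
  rewrite !mem.
  have e1 : u.2%:Z - u.1%:Z = cont u by [].
  have e2 : u.2.+1%:Z - u.1%:Z = cont u + 1 by rewrite /cont; lia.
  have e3 : u.2%:Z - u.1.+1%:Z = cont u - 1 by rewrite /cont; lia.
  have e4 : u.2.+1%:Z - u.1.+1%:Z = cont u by rewrite /cont; lia.
  rewrite e1 e2 e3 e4 -cuv in hv *.
  have := rho_step mu (cont u); have := rho_step nu (cont u).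
  have := rho_step mu (cont u - 1); have := rho_step nu (cont u - 1).
  rewrite subrK => *; split; lia.
have [i iE] : exists i, forall k,
    (k \in [fset cont u | u in skew_diagram nu mu]%fset) = (i < k <= i + n%:Z).
  apply: convex_interval; first by rewrite card_in_imfset.
  move=> _ _ z /imfsetP[u /= uR ->] /imfsetP[v /= vR ->] hz.
  apply: contraT => nz.
  have nR (a : skew_diagram nu mu) : cont (fsval a) != z.
    by apply: contra nz => /eqP <-; apply/imfsetP; exists (val a) => //; exact: valP.
  pose lt_z : pred (skew_diagram nu mu) := fun a => cont (fsval a) < z.
  (* The squares of content below z are closed under adjacency when no square has content z, so they
     cannot be connected to the others. *)
  have cl : closed (fun a b : skew_diagram nu mu => edge_adjacent (val a) (val b)) lt_z.
    move=> a b /edge_adjacent_cont; rewrite /in_mem /= /lt_z; have := nR a; have := nR b.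
    by move=> h1 h2 []; lia.
  have := closed_connect cl (conn [` uR]%fset [` vR]%fset).
  have := nR [` uR]%fset; rewrite /in_mem /= /lt_z /=; lia.
exists i, mu, nu; split=> //; apply: skew_addrib => // k.
rewrite -iE; split=> [/imfsetP[u /= uR ->]|[u uR <-]]; first by exists u.
by apply/imfsetP; exists u.
Qed.

Lemma card_skew_addrib i mu nu : addrib i mu nu -> #|` skew_diagram nu mu| = n.
Proof.
move=> h; rewrite -(card_int_range (i + 1) n).
have -> : int_range (i + 1) n = [fset cont u | u in skew_diagram nu mu]%fset.
  apply/fsetP => k; rewrite mem_int_range; apply/idP/imfsetP => [hk|[u /=]].
    exists (sq (rho mu k) k); last by rewrite cont_sq //; have := rho_ge mu k; lia.
    by rewrite /= mem_skew_sq // h; lia.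
  by rewrite (mem_addrib h) => + ->; lia.
rewrite [RHS]card_in_imfset // => u v /=; rewrite !(mem_addrib h) => /andP[_ /eqP h1] /andP[_ /eqP h2] e.
by apply: sq_inj; rewrite // h1 h2 e.
Qed.

Lemma addrib_ribbon i mu nu : addrib i mu nu -> is_ribbon n (skew_diagram nu mu).
Proof.
move=> h; have memE := mem_addrib h; split.
- by exists nu, mu; split=> //; exact: addrib_sub h.
- pose e := fun a b : skew_diagram nu mu => edge_adjacent (val a) (val b).
  have e_sym : symmetric e by move=> a b; rewrite /e /edge_adjacent; lia.
  have up (d : nat) (u v : skew_diagram nu mu) :
      cont (val v) = cont (val u) + d%:Z -> connect e u v.
    elim: d v => [|d IH] v cuv.
      have -> : u = v; last by [].
      apply: val_inj; apply: sq_inj; first by rewrite cuv addr0.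
      have := valP u; have := valP v; rewrite !memE cuv addr0.
      by move=> /andP[_ /eqP->] /andP[_ /eqP->].
    have hu := valP u; have hv := valP v; rewrite memE in hu; rewrite memE in hv.
    pose k : int := cont (val v) - 1; have ge := rho_ge mu k.
    have wS : sq (rho mu k) k \in skew_diagram nu mu.
      by rewrite mem_skew_sq // h; rewrite /k; lia.
    apply: (@connect_trans _ _ [` wS]%fset).
      apply: IH; rewrite [LHS](_ : _ = k); last by rewrite /= cont_sq //; lia.
      by rewrite /k cuv; lia.
    apply: connect1; rewrite /e /= /edge_adjacent /sq /=.
    have := rho_step mu k; have ek : k + 1 = cont (val v) by rewrite /k; lia.
    rewrite ek; move: hv => /andP[_ /eqP <-].
    have : cont (fsval v) = (fsval v).2%:Z - (fsval v).1%:Z by [].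
    by move: ek; rewrite /=; lia.
  move=> u v; have [le_uv|lt_vu] := lerP (cont (val u)) (cont (val v)).
    by apply: (up (absz (cont (val v) - cont (val u)))); lia.
  rewrite (sym_connect_sym e_sym).
  by apply: (up (absz (cont (val v) - cont (val u)))); lia.
- exact: card_skew_addrib h.
- case=> r [c []] h1 _ _ h2; move: h1 h2; rewrite !memE /=.
  have -> : cont (r.+1, c.+1) = cont (r, c) by rewrite /cont /=; lia.
  by move=> /andP[_ /eqP <-] /andP[_]; rewrite gtn_eqF.
Qed.

Lemma addrib_topright i mu nu : addrib i mu nu ->
  is_topright (skew_diagram nu mu) (sq (rho mu (i + n%:Z)) (i + n%:Z)).
Proof.
move=> h; apply: toprightI; first by rewrite mem_skew_sq // h; lia.
move=> v; rewrite (mem_addrib h) /sq /= => hv.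
have [le1 le2] : (rho mu (i + n%:Z) <= rho mu (cont v))%N /\
    (rho mu (cont v))%:Z <= (rho mu (i + n%:Z))%:Z + (i + n%:Z - cont v).
  by apply: rho_mono; lia.
have := rho_ge mu (i + n%:Z).
have : cont v = v.2%:Z - v.1%:Z by [].
lia.
Qed.

Lemma topright_cont i mu nu u : addrib i mu nu ->
  is_topright (skew_diagram nu mu) u -> cont u = i + n%:Z.
Proof.
move=> h /topright_uniq /(_ (addrib_topright h)) ->.
by rewrite cont_sq //; have := rho_ge mu (i + n%:Z); lia.
Qed.

(** The rows met by the ribbon are the values of [rho mu] on i+1, ..., i+n, and by unit steps these
    fill an interval. *)
Lemma spin_addrib i mu nu : addrib i mu nu -> spin (skew_diagram nu mu) = nbeads mu i.
Proof.
move=> h; rewrite /spin /nbeads.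
have eN : i + 1 + n.-1%:Z = i + n%:Z by lia.
have le := rhoDl mu (i + 1) n.-1; rewrite eN in le.
suff -> : [fset u.1 | u in skew_diagram nu mu]%fset =
    [fset x in iota (rho mu (i + n%:Z)) (rho mu (i + 1) - rho mu (i + n%:Z)).+1]%fset.
  by rewrite card_fseq undup_id ?iota_uniq // size_iota.
have mem_iotaE a b (r : nat) : (r \in [fset x in iota a b]%fset) = (a <= r < a + b)%N.
  by rewrite in_fset /= mem_iota.
apply/fsetP => r; rewrite mem_iotaE; apply/imfsetP/idP => [[u /=]|hr].
  rewrite (mem_addrib h) => /andP[hu /eqP eu] ->; rewrite eu.
  have [l1 _] : (rho mu (i + n%:Z) <= rho mu (cont u))%N /\
    (rho mu (cont u))%:Z <= (rho mu (i + n%:Z))%:Z + (i + n%:Z - cont u).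
    by apply: rho_mono; lia.
  have [l2 _] : (rho mu (cont u) <= rho mu (i + 1))%N /\
    (rho mu (i + 1))%:Z <= (rho mu (cont u))%:Z + (cont u - (i + 1)).
    by apply: rho_mono; lia.
  lia.
have [|j lej ej] := @rho_ivt mu (i + 1) n.-1 r; first by rewrite eN; lia.
exists (sq r (i + 1 + j%:Z)) => //=.
by rewrite mem_skew_sq ?ej // h ej; lia.
Qed.

End Ribbons.

(** * Horizontal strips as increasing sequences of bead moves *)

Section Strips.
Variable n : nat.
Hypothesis n_gt0 : (0 < n)%N.

(** No order is imposed on [J]: the same paths serve for horizontal strips (increasing [J]),
    vertical strips (decreasing [J]) and conjugation, which exchanges the two. The spins add up in
    [t]. *)
Fixpoint upath (J : seq int) (mu la : intpart) (t : nat) : Prop :=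
  if J is i :: J' then
    exists nu t', [/\ addrib n i mu nu, upath J' nu la t' & t = (nbeads n mu i + t')%N]
  else mu = la /\ t = 0%N.

Lemma upath_le J mu la t : upath J mu la t -> forall k, (rho mu k <= rho la k)%N.
Proof.
elim: J mu t => [|i J IH] mu t /=; first by case=> ->.
by case=> nu [t' [h /IH + _]] k => /(_ k); rewrite h; lia.
Qed.

Lemma upath_stable J mu la t (k : int) : upath J mu la t -> all (fun j => k <= j) J ->
  rho la k = rho mu k.
Proof.
elim: J mu t => [|i J IH] mu t /=; first by case=> ->.
by case=> nu [t' [h p _]] /andP[le_ki al]; rewrite (IH _ _ p al) h; lia.
Qed.

Lemma sorted_cons_ge (i : int) J : sorted <%R (i :: J) ->
  [/\ sorted <%R J & all (fun j => i + 1 <= j) J].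
Proof.
move=> /= pt; split; first exact: path_sorted pt.
have := order_path_min (leT := <%R) lt_trans pt.
by apply: sub_all => j /=; lia.
Qed.

Lemma upath_first (i : int) J mu la t : upath (i :: J) mu la t -> sorted <%R (i :: J) ->
  rho la i = rho mu i /\ rho la (i + 1) = (rho mu (i + 1)).+1.
Proof.
case=> nu [t' [h p _]] /sorted_cons_ge[_ al].
rewrite (upath_stable p) ?(upath_stable p (k := i + 1)) ?h //; first by lia.
by apply: sub_all al => j; lia.
Qed.

(** The endpoints determine an increasing path: its first position i is where the profiles still
    agree at every k <= i and differ at i+1. *)
Lemma upath_uniq J J' mu la t t' : upath J mu la t -> upath J' mu la t' ->
  sorted <%R J -> sorted <%R J' -> J = J' /\ t = t'.
Proof.
elim: J J' mu t t' => [|i J IH] [|i' J'] mu t t'.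
- by move=> /= [_ ->] [_ ->].
- by case=> <- _ /upath_first h _ /h; lia.
- by move=> p [e _] s _; subst la; have := upath_first p s; lia.
move=> p p' s s'.
have [h1 h2] := upath_first p s; have [h1' h2'] := upath_first p' s'.
have ge_ (a b : int) K u : upath (b :: K) mu la u -> sorted <%R (b :: K) ->
    rho la (a + 1) = (rho mu (a + 1)).+1 -> b <= a.
  move=> q /sorted_cons_ge[_ al] ea; rewrite leNgt; apply/negP => lt_ab.
  have := upath_stable (k := a + 1) q; rewrite ea /=.
  have -> : a + 1 <= b by lia.
  have -> : all (fun j : int => a + 1 <= j) K by apply: sub_all al => j; lia.
  by move=> /(_ isT); lia.
have ei : i = i'.
  by have := ge_ _ _ _ _ p s h2'; have := ge_ _ _ _ _ p' s' h2; lia.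
subst i'; case: p p' => nu [u [hn p ->]] [nu' [u' [hn' p' ->]]].
have enu := addrib_injr hn hn'; subst nu'.
have [sJ _] := sorted_cons_ge s; have [sJ' _] := sorted_cons_ge s'.
by have [-> ->] := IH _ _ _ _ p p' sJ sJ'.
Qed.

Lemma mem_fcover (P : {fset {fset square}}) (u : square) :
  reflect (exists2 R, R \in P & u \in R) (u \in fcover P).
Proof.
apply: (iffP (bigfcupP _ _ _ _)) => [[R /andP[RP _] uR]|[R RP uR]]; exists R => //.
by rewrite RP.
Qed.

(* Among the ribbons of a strip tiling of la/mu, the one with the leftmost head
   can be added to mu first: otherwise another ribbon would run strictly
   north-west of it up to its head, which would not lie on the northern edge. *)
Lemma tiling_upath (m : nat) (mu la : intpart) (P : {fset {fset square}}) :
  part_sub mu la -> #|` P| = m -> is_strip_tiling n (skew_diagram la mu) P ->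
  exists J t, [/\ upath J mu la t, sorted <%R J, size J = m,
    t = (\sum_(R <- P) spin R)%N &
    forall j, j \in J -> exists R u, [/\ R \in P, is_topright R u & cont u = j + n%:Z]].
Proof.
elim: m mu P => [|m IH] mu P sub cardP [cov triv strip].
  have P0 : P = fset0 by apply/eqP; rewrite -cardfs_eq0 cardP.
  exists [::], 0%N; split=> //; last by rewrite P0 big_seq_fset0.
  split=> //; apply: rho_inj => k; have /part_subP/(_ k) le := sub.
  apply/eqP; rewrite eqn_leq le leqNgt; apply/negP => lt.
  have := mem_skew_sq la (leqnn (rho mu k)); rewrite -cov P0 lt.
  by case/mem_fcover => R; rewrite in_fset0.
have [R|rb rbP] := @choice {fset square} (int * (intpart * intpart))
    (fun R y => R \in P -> addrib n y.1 y.2.1 y.2.2 /\ R = skew_diagram y.2.2 y.2.1).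
  case: (boolP (R \in P)) => [RP|_]; last by exists (0, (mu, mu)).
  have [rR _] := strip R RP; have [i [a [b [h e]]]] := ribbon_addrib n_gt0 rR.
  by exists (i, (a, b)).
pose ix R : int := (rb R).1; pose row R := rho (rb R).2.1.
have memR R (u : square) : R \in P ->
    (u \in R) = (ix R < cont u <= ix R + n%:Z) && (u.1 == row R (cont u)).
  by move=> RP; have [h e] := rbP R RP; rewrite {1}e (mem_addrib n_gt0 h).
have memS R (u : square) : R \in P -> u \in R -> (rho mu (cont u) <= u.1 < rho la (cont u))%N.
  by move=> RP uR; rewrite -mem_skew -cov; apply/mem_fcover; exists R.
have Smem (u : square) : (rho mu (cont u) <= u.1 < rho la (cont u))%N -> exists2 R, R \in P & u \in R.
  by rewrite -mem_skew -cov => /mem_fcover.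
have disj R R' (u : square) : R \in P -> R' \in P -> u \in R -> u \in R' -> R = R'.
  move=> RP RP' uR uR'; apply/eqP; apply: contraT => ne.
  have /trivIfsetP/(_ R R' RP RP' ne)/fdisjointP/(_ u uR) := triv.
  by rewrite uR'.
have row_ge R (k : int) : - (row R k)%:Z <= k by have := rho_ge (rb R).2.1 k; rewrite /row; lia.
have inR R (k : int) : R \in P -> ix R < k <= ix R + n%:Z -> sq (row R k) k \in R.
  by move=> RP hk; rewrite memR // cont_sq ?row_ge // hk eqxx.
have north R (u : square) : R \in P -> u \in R -> cont u = ix R + n%:Z ->
    (u.1 == 0%N) || (rho la (cont u + 1) < u.1)%N || (u.1 <= rho mu (cont u + 1))%N.
  move=> RP uR cu; have [_ [v vtop vnorth]] := strip R RP.
  have [hadd eR] := rbP R RP.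
  have uv : u = v.
    have := topright_cont n_gt0 hadd; rewrite -eR => /(_ v vtop) cv.
    have [vR _] := vtop; move: uR vR; rewrite !memR // cu cv => /andP[_ /eqP eu] /andP[_ /eqP ev].
    by apply: sq_inj; rewrite ?cu ?cv // eu ev.
  subst v; case eu: u.1 => [|r] //=.
  have := vnorth r eu; rewrite mem_skew.
  have -> : cont (r, u.2) = cont u + 1 by rewrite /cont eu /=; lia.
  by rewrite /=; lia.
(* Walk from [a] and [b] towards the head of [R], d diagonals away; [R'] reaches at least as far.
   Rows drop by at most 1 per diagonal and the ribbons are disjoint, so [R'] stays strictly above
   [R]. At the head this puts the square above it inside the shape, against [north]. *)
have noncross (d : nat) (R R' : {fset square}) (a b : square) : R \in P -> R' \in P -> R != R' -> ix R <= ix R' ->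
    a \in R' -> b \in R -> cont a = cont b -> cont b + d%:Z = ix R + n%:Z -> ~ (a.1 < b.1)%N.
  move=> RP R'P neR leix; elim: d a b => [|d IHd] a b aR bR cab cb lt_ab.
    have := north R b RP bR; rewrite -cb addr0 => /(_ erefl).
    have := memS _ _ R'P aR; have := memS _ _ RP bR; rewrite cab.
     have := rho_step mu (cont b); have := rho_step la (cont b); lia.
  have ha := aR; have hb := bR; rewrite memR // in ha; rewrite memR // in hb.
  rewrite cab in ha.
  have a'R : sq (row R' (cont b + 1)) (cont b + 1) \in R' by apply: inR => //; lia.
  have b'R : sq (row R (cont b + 1)) (cont b + 1) \in R by apply: inR => //; lia.
  apply: (IHd _ _ a'R b'R); rewrite ?cont_sq ?row_ge //; first by lia.
  rewrite /= ltn_neqAle; apply/andP; split.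
    apply: contra neR => /eqP e; rewrite e in a'R; apply/eqP; exact: disj b'R a'R.
  by have := rho_step (rb R').2.1 (cont b); have := rho_step (rb R).2.1 (cont b); rewrite /row in ha hb *; lia.
have [R0 R0P R0min] : exists2 R0, R0 \in P & forall R, R \in P -> ix R0 <= ix R.
  have [R1 R1P] : exists R, R \in P by apply/fset0Pn; rewrite -cardfs_gt0 cardP.
  have [i /mapP[R0 R0P ->] imin] := int_min (map_f ix R1P).
  by exists R0 => // R RP; apply: imin; exact: map_f.
(* Ribbons with the same first position have heads on one diagonal; [noncross] in both directions
   puts them in the same row, so the ribbons share a square. *)
have R0lt R : R \in P -> R != R0 -> ix R0 < ix R.
  move=> RP ne; have := R0min R RP; rewrite le_eqVlt => /predU1P[eix|//]; exfalso.
  pose k := ix R0 + n%:Z.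
  have aR : sq (row R0 k) k \in R0 by apply: inR => //; rewrite /k; lia.
  have bR : sq (row R k) k \in R by apply: inR => //; rewrite /k -eix; lia.
  have neq' : R0 != R by rewrite eq_sym.
  have ck R1 : cont (sq (row R1 k) k) = k by rewrite cont_sq ?row_ge.
  have nc1 := noncross 0%N R0 R _ _ R0P RP neq' (R0min R RP) bR aR.
  have nc2 := noncross 0%N R R0 _ _ RP R0P ne _ aR bR.
  rewrite !ck addr0 /= in nc1 nc2.
  have {}nc1 := nc1 erefl erefl.
  have {}nc2 := nc2 _ erefl _.
  have e : row R0 k = row R k by rewrite /k eix in nc1 nc2 *; lia.
  by case/eqP: ne; rewrite e in aR; exact: disj bR aR.
pose i0 := ix R0.
(* [R0] lies directly against [mu]: otherwise its north-west diagonal neighbour is in the shape, and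
   the ribbon containing it crosses [R0]. *)
have row0 (k : int) : i0 < k <= i0 + n%:Z -> row R0 k = rho mu k.
  move=> hk; have vR := inR _ _ R0P hk; have := memS _ _ R0P vR.
  have ck : cont (sq (row R0 k) k) = k by rewrite cont_sq ?row_ge.
  rewrite ck /= => /andP[le_mu lt_la]; apply/eqP; rewrite eqn_leq le_mu andbT leqNgt.
  apply/negP => lt_mu.
  have cw : cont (sq (row R0 k).-1 k) = k by rewrite cont_sq //; have := rho_ge mu k; lia.
  have [|R' R'P wR'] := Smem (sq (row R0 k).-1 k); first by rewrite cw /=; lia.
  have neR : R0 != R'.
    by apply/eqP => e; move: wR'; rewrite -e memR // cw /=; lia.
  pose d := absz (i0 + n%:Z - k)%R.
  apply: (noncross d R0 R' _ _ R0P R'P neR (R0min _ R'P) wR' vR); rewrite ?ck ?cw //=; last by lia.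
  by rewrite /d /i0 in hk *; lia.
(* Without a bead at i0, the shape would have a square of content i0, in a ribbon starting further
   left than [R0]. The hole at i0+n expresses that the head of [R0] lies on the northern edge. *)
have can0 : canadd n mu i0.
  rewrite /canadd /bead; apply/andP; split.
    apply/negP => /eqP e.
    have hk : i0 < i0 + 1 <= i0 + n%:Z by lia.
    have := memS _ _ R0P (inR _ _ R0P hk); rewrite row0 // -e cont_sq /=; last by have := rho_ge mu i0; lia.
    have ge := rho_ge mu i0; move=> hS.
    have cw : cont (sq (rho mu i0) i0) = i0 by rewrite cont_sq //; lia.
    have [|R' R'P wR'] := Smem (sq (rho mu i0) i0).
      by rewrite cw /=; have := rho_step la i0; lia.
    have := R0min _ R'P; move: wR'; rewrite memR // cw /i0; lia.
  apply/negP => ne; pose k := i0 + n%:Z.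
  have hk : i0 < k <= i0 + n%:Z by rewrite /k; lia.
  have vR := inR _ _ R0P hk; rewrite row0 // in vR.
  have ck : cont (sq (rho mu k) k) = k by rewrite cont_sq //; have := rho_ge mu k; lia.
  have := memS _ _ R0P vR; have := north _ _ R0P vR; rewrite ck => /(_ erefl) /=.
  by have := rho_step mu k; have := rho_step la k; move: ne; rewrite -/k; lia.
have [nu nuP] := canadd_addrib n_gt0 can0.
have eR0 : R0 = skew_diagram nu mu.
  apply/fsetP => u; rewrite (mem_addrib n_gt0 nuP) memR // -/i0.
  by case hk: (i0 < cont u <= i0 + n%:Z) => //=; rewrite row0.
have sub' : part_sub nu la.
  apply/part_subP => k; rewrite nuP; have := elimT (part_subP mu la) sub k.
  case: (boolP (i0 < k <= i0 + n%:Z)) => hk le_k; last by rewrite addn0.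
  have := memS _ _ R0P (inR _ _ R0P hk); rewrite cont_sq ?row_ge // row0 //=; lia.
have memS' (u : square) : (u \in skew_diagram la nu) = (u \in skew_diagram la mu) && (u \notin R0).
  rewrite (memR R0) // !mem_skew nuP -/i0; case: (boolP (i0 < cont u <= i0 + n%:Z)) => hk /=; last by lia.
  by rewrite row0 //; lia.
have [] := IH nu (P `\ R0)%fset sub'.
- by move: cardP; rewrite (cardfsD1 R0) R0P; lia.
- split.
  + apply/fsetP => u; rewrite memS' -cov; apply/mem_fcover/andP.
      case=> R; rewrite in_fsetD1 => /andP[ne RP] uR; split; first by apply/mem_fcover; exists R.
      by apply: contra ne => uR0; apply/eqP; exact: disj uR uR0.
    case=> /mem_fcover[R RP uR] uR0; exists R => //; rewrite in_fsetD1 RP andbT.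
    by apply: contra uR0 => /eqP <-.
  + apply/trivIfsetP => A B; rewrite !in_fsetD1 => /andP[_ AP] /andP[_ BP].
    exact: (elimT (trivIfsetP P) triv).
  + move=> R; rewrite in_fsetD1 => /andP[_ RP]; have [rR [u utop unorth]] := strip R RP.
    split=> //; exists u => // r /unorth; rewrite memS'; by apply: contra => /andP[].
move=> J [t [pJ sJ szJ tJ headJ]].
exists (i0 :: J), (nbeads n mu i0 + t)%N; split.
- by exists nu, t.
- rewrite /= path_min_sorted //; apply/allP => j /headJ[R [u [RP utop cu]]].
  move: RP; rewrite in_fsetD1 => /andP[ne RP].
  have [hadd eR] := rbP R RP.
  have := topright_cont n_gt0 hadd; rewrite -eR => /(_ u utop).
  by have := R0lt R RP ne; rewrite cu /i0 /ix /=; lia.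
- by rewrite /= szJ.
- by rewrite (big_fsetD1 R0) //= tJ {2}eR0 (spin_addrib n_gt0 nuP).
- move=> j; rewrite inE => /predU1P[->|/headJ[R [u [RP utop cu]]]].
    exists R0, (sq (rho mu (i0 + n%:Z)) (i0 + n%:Z)); split=> //.
      by rewrite eR0; exact: addrib_topright.
    by rewrite cont_sq //; have := rho_ge mu (i0 + n%:Z); lia.
  by exists R, u; split=> //; move: RP; rewrite in_fsetD1 => /andP[].
Qed.

(** The square above the head of the first ribbon is in [mu], by the hole at i+n. For a later ribbon
    it has content j+n+1 > i+n, beyond every square of the first ribbon; the second conclusion
    records the head contents for this purpose. *)
Lemma upath_tiling J mu la t : upath J mu la t -> sorted <%R J ->
  exists2 P, is_strip_tiling n (skew_diagram la mu) P &
    forall R, R \in P -> exists2 j, j \in J & forall u, is_topright R u -> cont u = j + n%:Z.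
Proof.
elim: J mu t => [|i J IH] mu t.
  case=> -> _ _; exists fset0; last by move=> R; rewrite in_fset0.
  split; last by move=> R; rewrite in_fset0.
    apply/fsetP => u; rewrite mem_skew; apply/mem_fcover/idP => [[R]|]; first by rewrite in_fset0.
    by move=> h1; have := leq_ltn_trans (andP h1).1 (andP h1).2; rewrite ltnn.
  by apply/trivIfsetP => A B; rewrite in_fset0.
case=> nu [t' [h p _]] /[dup] /sorted_cons_ge[sJ alJ] sJi.
have [P [cov triv strip] PJ] := IH _ _ p sJ.
have le1 := elimT (part_subP mu nu) (addrib_sub h); have le2 := upath_le p.
pose R0 := skew_diagram nu mu.
have memS (u : square) : (u \in skew_diagram la mu) = (u \in R0) || (u \in fcover P).
  by rewrite cov !mem_skew; have := le1 (cont u); have := le2 (cont u); lia.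
have dis (R : {fset square}) u : R \in P -> u \in R -> u \notin R0.
  move=> RP uR; have : u \in fcover P by apply/mem_fcover; exists R.
  by rewrite cov !mem_skew; lia.
have memR0 u : u \in R0 -> i < cont u <= i + n%:Z by rewrite (mem_addrib n_gt0 h) => /andP[].
exists (R0 |` P)%fset; last first.
  move=> R; rewrite in_fset1U => /predU1P[->|RP].
    by exists i; rewrite ?mem_head // => u; exact: topright_cont.
  by have [j jJ hj] := PJ R RP; exists j; rewrite // inE jJ orbT.
split.
- apply/fsetP => u; rewrite memS; apply/mem_fcover/orP.
    case=> R; rewrite in_fset1U => /predU1P[->|RP] uR; [by left|right].
    by apply/mem_fcover; exists R.
  case=> [uR|/mem_fcover[R RP uR]]; first by exists R0; rewrite // in_fset1U eqxx.
  by exists R; rewrite // in_fset1U RP orbT.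
- apply/trivIfsetP => A B; rewrite !in_fset1U => /predU1P[->|AP] /predU1P[->|BP]; rewrite ?eqxx //.
  + by move=> _; rewrite fdisjoint_sym; apply/fdisjointP => u; exact: dis.
  + by move=> _; apply/fdisjointP => u; exact: dis.
  + exact: (elimT (trivIfsetP P) triv).
move=> R; rewrite in_fset1U => /predU1P[->|RP].
  split; first exact: addrib_ribbon.
  exists (sq (rho mu (i + n%:Z)) (i + n%:Z)); first exact: addrib_topright.
  move=> r er; rewrite mem_skew.
  have -> : cont (r, (sq (rho mu (i + n%:Z)) (i + n%:Z)).2) = i + n%:Z + 1.
    have : cont (sq (rho mu (i + n%:Z)) (i + n%:Z)) = i + n%:Z.
      by rewrite cont_sq //; have := rho_ge mu (i + n%:Z); lia.
    by move: er; rewrite /cont /=; lia.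
  have := addrib_canadd n_gt0 h; rewrite /canadd /bead.
  by move: er; rewrite /sq /=; have := rho_step mu (i + n%:Z); lia.
have [rR [u utop unorth]] := strip R RP; split=> //; exists u => // r eu.
rewrite memS cov negb_or unorth // andbT.
apply/negP => /memR0; have [j jJ /(_ u utop) cu] := PJ R RP.
have -> : cont (r, u.2) = cont u + 1 by move: eu; rewrite /cont /=; lia.
by have := allP alJ _ jJ; rewrite cu; lia.
Qed.

Lemma hstripP mu la : is_horizontal_strip n la mu <->
  exists J t, upath J mu la t /\ sorted <%R J.
Proof.
split=> [[sub [P tiling]]|[J [t [p sJ]]]].
  by have [J [t [p sJ _ _ _]]] := tiling_upath sub erefl tiling; exists J, t.
have [P tiling _] := upath_tiling p sJ; split; last by exists P.
by apply/part_subP; exact: upath_le p.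
Qed.

(** [strip_ribbons] is an arbitrary choice of tiling. Any tiling yields an increasing path, and this
    path is unique, so the number of ribbons and the spin do not depend on the choice. *)
Lemma strip_ribbons_upath J mu la t : upath J mu la t -> sorted <%R J ->
  #|` strip_ribbons n la mu| = size J /\ (\sum_(R <- strip_ribbons n la mu) spin R)%N = t.
Proof.
move=> p sJ; have [P tiling _] := upath_tiling p sJ.
have sub : part_sub mu la by apply/part_subP; exact: upath_le p.
have tiling' : is_strip_tiling n (skew_diagram la mu) (strip_ribbons n la mu).
  exact: (@xgetI _ fset0 [set P | is_strip_tiling n (skew_diagram la mu) P]%classic P).
have [J' [t' [p' sJ' sz et _]]] := tiling_upath sub erefl tiling'.
by have [eJ e] := upath_uniq p p' sJ sJ'; rewrite eJ sz e et.
Qed.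

End Strips.

(** * Cores and conjugation *)

Section Cores.
Variable n : nat.
Hypothesis n_gt0 : (0 < n)%N.

Lemma addrib_bead i mu nu k : addrib n i mu nu ->
  bead nu k = if k == i then false else if k == i + n%:Z then true else bead mu k.
Proof.
move=> h; have := addrib_canrem n_gt0 h; rewrite /canrem => /andP[/negbTE bi bin].
have [->//|ni] := eqVneq k i; have [->//|nin] := eqVneq k (i + n%:Z).
by rewrite /bead !h; lia.
Qed.

(** The two moves never share a position: if j = i+n or i = j+n, it would be both a bead and a hole
    of [nu]. *)
Lemma addrib_diamond_dn i j mu ka nu : i != j ->
  addrib n i mu nu -> addrib n j ka nu ->
  exists2 al, addrib n j al mu & addrib n i al ka.
Proof.
move=> ne hi hj.
have [|al hal] := canrem_addrib n_gt0 (i := j) (nu := mu).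
  have := addrib_canrem n_gt0 hj; rewrite /canrem !(addrib_bead _ hi).
  have -> : (j == i) = false by rewrite eq_sym (negbTE ne).
  have -> : (j + n%:Z == i + n%:Z) = false by lia.
  by do 2![case: ifP => _]; rewrite ?andbF.
exists al => // k; have := hi k; have := hj k; have := hal k; lia.
Qed.

Lemma addrib_diamond_up i j mu ka al : i != j ->
  addrib n j al mu -> addrib n i al ka ->
  exists2 nu, addrib n i mu nu & addrib n j ka nu.
Proof.
move=> ne hj hi.
have [|nu hnu] := canadd_addrib n_gt0 (i := i) (mu := mu).
  have := addrib_canadd n_gt0 hi; rewrite /canadd !(addrib_bead _ hj) (negbTE ne).
  have -> : (i + n%:Z == j + n%:Z) = false by lia.
  by move=> /andP[bi bin]; do 2![case: ifP => _]; rewrite ?bi ?bin.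
exists nu => // k; have := hi k; have := hj k; have := hnu k; lia.
Qed.

(** Both ways from [al] to [nu] have the same total spin: when the jumps interleave, performing one
    first makes the other pass one bead more or less, with opposite signs in the two orders. The
    terms are arranged for exchanging an addition at i with a removal at j. *)
Lemma addrib_nbeads_swap i j mu ka al nu : i != j ->
  addrib n j al mu -> addrib n i al ka -> addrib n i mu nu -> addrib n j ka nu ->
  (nbeads n mu i + nbeads n nu j = nbeads n mu j + nbeads n ka i)%N.
Proof.
move=> ne h1 h2 h3 h4; rewrite (addrib_nbeads n_gt0 h1) (addrib_nbeads n_gt0 h2) (addrib_nbeads n_gt0 h4).
have := rhoDl al (i + 1) n.-1; have := rhoDl al (j + 1) n.-1.
have := rhoDl mu (i + 1) n.-1; have := rhoDl ka (j + 1) n.-1.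
have -> : i + 1 + n.-1%:Z = i + n%:Z by lia.
have -> : j + 1 + n.-1%:Z = j + n%:Z by lia.
by rewrite /nbeads !h1 !h2; lia.
Qed.

Lemma removes_ribbonP la mu : removes_ribbon n la mu <-> exists i, addrib n i mu la.
Proof.
split=> [[sub rib]|[i h]]; last by split; [exact: addrib_sub h|exact: addrib_ribbon].
have [i [mu' [la' [h e]]]] := ribbon_addrib n_gt0 rib.
exists i; apply: skew_addrib => //; rewrite e.
  move=> u v; rewrite !(mem_addrib n_gt0 h) => /andP[_ /eqP h1] /andP[_ /eqP h2] c.
  by apply: sq_inj; rewrite // h1 h2 c.
move=> k; split=> [hk|[u]]; last by rewrite (mem_addrib n_gt0 h) => + <- => /andP[].
have ck : cont (sq (rho mu' k) k) = k by rewrite cont_sq //; have := rho_ge mu' k; lia.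
by exists (sq (rho mu' k) k); rewrite // (mem_addrib n_gt0 h) ck /= hk eqxx.
Qed.

Lemma card_diagram_addrib i mu la : addrib n i mu la ->
  #|` diagram la| = (#|` diagram mu| + n)%N.
Proof.
move=> h; have sub : (diagram mu `<=` diagram la)%fset := addrib_sub h.
have := cardfsD (diagram la) (diagram mu); rewrite (fsetIidPr sub).
have := card_skew_addrib n_gt0 h; rewrite /skew_diagram.
by have := fsubset_leq_card sub; lia.
Qed.

Definition irreducible (de : intpart) := forall i mu, ~ addrib n i mu de.

Lemma core_exists la : exists2 de, removes_ribbons n la de & irreducible de.
Proof.
have [m] := ubnP #|` diagram la|; elim: m la => // m IH la lem.
have [[i [mu h]]|no] := pselect (exists i mu, addrib n i mu la).
  have [|de rem irr] := IH mu; first by have := card_diagram_addrib h; lia.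
  by exists de => //; apply: removes_step rem; apply/removes_ribbonP; exists i.
by exists la; [exact: removes_none|move=> i mu h; apply: no; exists i, mu].
Qed.

(** Confluence: two different first removals meet again by the diamond, and induction on the size
    identifies the cores below them. *)
Lemma core_uniq la de de' : removes_ribbons n la de -> irreducible de ->
  removes_ribbons n la de' -> irreducible de' -> de = de'.
Proof.
have [m] := ubnP #|` diagram la|; elim: m la de de' => // m IH la de de' lem.
move=> r1; case: _ _ / r1 lem => [la1|la1 mu1 de1 /removes_ribbonP[i hi] r1] lem irr r2.
  by case: _ _ / r2 irr lem => [//|la2 mu2 de2 /removes_ribbonP[j hj] _ irr]; case: (irr _ _ hj).
move=> irr2; case: _ _ / r2 irr2 hi lem => [la2|la2 mu2 de2 /removes_ribbonP[j hj] r2] irr2 hi lem.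
  by case: (irr2 _ _ hi).
have le1 := card_diagram_addrib hi; have le2 := card_diagram_addrib hj.
have [eij|nij] := eqVneq i j.
  by subst j; have e := addrib_injl n_gt0 hi hj; subst mu2; apply: (IH mu1) => //; lia.
have [al h1 h2] := addrib_diamond_dn nij hi hj.
have [de3 r3 irr3] := core_exists al.
have -> : de1 = de3.
  by apply: (IH mu1) => //; [lia|apply: removes_step r3; apply/removes_ribbonP; exists j].
by apply: (IH mu2) => //; [lia|apply: removes_step r3; apply/removes_ribbonP; exists i].
Qed.

Lemma ncore_spec la : removes_ribbons n la (ncore n la) /\ irreducible (ncore n la).
Proof.
have [de r irr] := core_exists la.
have [r' irr'] : [set de | removes_ribbons n la de /\
    forall mu, ~ removes_ribbon n de mu]%classic (ncore n la).
  by apply: (xgetI la (x := de)); split=> // mu /removes_ribbonP[i]; exact: irr.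
by split=> // i mu h; apply: (irr' mu); apply/removes_ribbonP; exists i.
Qed.
Lemma ncore_unique la de : removes_ribbons n la de -> irreducible de -> ncore n la = de.
Proof. by move=> r irr; have [r' irr'] := ncore_spec la; exact: core_uniq r' irr' r irr. Qed.

Lemma is_ncore_irreducible de : is_ncore n de -> irreducible de.
Proof. by move=> <-; case: (ncore_spec de). Qed.

Lemma ncore_addrib i mu la : addrib n i mu la -> ncore n la = ncore n mu.
Proof.
move=> h; have [r irr] := ncore_spec mu; apply: ncore_unique => //.
by apply: removes_step r; apply/removes_ribbonP; exists i.
Qed.

Lemma ncore_upath J mu la t : upath n J mu la t -> ncore n la = ncore n mu.
Proof.
elim: J mu t => [|i J IH] mu t /=; first by case=> ->.
by case=> nu [t' [/ncore_addrib <- /IH]].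
Qed.

(** Conjugation reflects the Maya diagram by k -> -1-k and swaps beads with holes, so a jump from i
    to i+n becomes a jump from -1-(i+n) to -1-i. *)
Definition conjpos (i : int) : int := - i - n%:Z - 1.

Lemma conjposK : involutive conjpos.
Proof. by move=> i; rewrite /conjpos; lia. Qed.

Lemma addrib_conj i mu la : addrib n i mu la ->
  addrib n (conjpos i) (conj_part mu) (conj_part la).
Proof.
move=> h k; have := rho_conj mu k; have := rho_conj la k; rewrite h /conjpos; lia.
Qed.

(** Each of the n-1 positions strictly between the ends of the jump is a bead in exactly one of the
    two diagrams. *)
Lemma nbeads_conj mu i : (nbeads n (conj_part mu) (conjpos i) + nbeads n mu i = n.-1)%N.
Proof.
have := rho_conj mu (conjpos i + 1); have := rho_conj mu (conjpos i + n%:Z).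
have := rhoDl mu (i + 1) n.-1.
have -> : i + 1 + n.-1%:Z = i + n%:Z by lia.
rewrite /nbeads.
have -> : - (conjpos i + 1) = i + n%:Z by rewrite /conjpos; lia.
have -> : - (conjpos i + n%:Z) = i + 1 by rewrite /conjpos; lia.
rewrite /conjpos; lia.
Qed.

Lemma upath_conj J mu la t : upath n J mu la t ->
  exists2 t', upath n (map conjpos J) (conj_part mu) (conj_part la) t' &
              (t' + t = n.-1 * size J)%N.
Proof.
elim: J mu t => [|i J IH] mu t /=; first by case=> -> ->; exists 0%N; rewrite ?muln0.
case=> nu [t1 [h /IH[t' p' e] ->]].
exists (nbeads n (conj_part mu) (conjpos i) + t')%N; last by have := nbeads_conj mu i; lia.
by exists (conj_part nu), t'; split=> //; exact: addrib_conj.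
Qed.

Lemma upath_rcons J i mu la t : upath n (rcons J i) mu la t <->
  exists nu t', [/\ upath n J mu nu t', addrib n i nu la & t = (t' + nbeads n nu i)%N].
Proof.
elim: J mu t => [|j J IH] mu t /=.
  split=> [[nu [t' [h [e1 e2] e3]]]|[nu [t' [[e1 e2] h e3]]]]; subst.
    by exists mu, 0%N; rewrite addn0.
  by exists la, 0%N; rewrite addn0.
split=> [[nu [t' [h /IH[al [u [p ha ->]]] ->]]]|[nu [t' [[al [u [h p ->]]] ha ->]]]].
  by exists al, (nbeads n mu j + u)%N; split; rewrite ?addnA //; exists nu, u.
exists al, (u + nbeads n nu i)%N; rewrite addnA; split=> //; apply/IH.
by exists nu, u.
Qed.

Lemma ncore_conj la : ncore n (conj_part la) = conj_part (ncore n la).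
Proof.
have [r irr] := ncore_spec la; apply: ncore_unique; last first.
  move=> i mu /addrib_conj; rewrite conj_partK; exact: irr.
elim: r => [mu|al mu nu /removes_ribbonP[i h] _ r]; first exact: removes_none.
by apply: removes_step r; apply/removes_ribbonP; exists (conjpos i); exact: addrib_conj.
Qed.

Lemma card_diagram_upath J mu la t : upath n J mu la t ->
  #|` diagram la| = (#|` diagram mu| + n * size J)%N.
Proof.
elim: J mu t => [|i J IH] mu t /=; first by case=> ->; rewrite muln0 addn0.
by case=> nu [t' [/card_diagram_addrib h /IH -> _]]; rewrite h mulnS addnA.
Qed.

End Cores.

(** * Operators adding and removing ribbons *)

Section Operators.
Variable n : nat.
Hypothesis n_gt0 : (0 < n)%N.
Variables (R : comNzRingType) (p : R).

Definition addr (i : int) (mu : intpart) : intpart :=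
  xget mu [set nu | addrib n i mu nu]%classic.
Definition remr (i : int) (nu : intpart) : intpart :=
  xget nu [set mu | addrib n i mu nu]%classic.

Lemma addrP i mu : canadd n mu i -> addrib n i mu (addr i mu).
Proof. by move=> /(canadd_addrib n_gt0) h; exact: xgetPex h. Qed.

Lemma remrP i nu : canrem n nu i -> addrib n i (remr i nu) nu.
Proof. by move=> /(canrem_addrib n_gt0) h; exact: xgetPex h. Qed.

Lemma addr_eq i mu nu : addrib n i mu nu -> addr i mu = nu.
Proof.
by move=> h; apply: (addrib_injr (n := n) (i := i) (mu := mu)) => //; apply: addrP; exact: addrib_canadd h.
Qed.

Lemma remr_eq i mu nu : addrib n i mu nu -> remr i nu = mu.
Proof.
by move=> h; apply: (addrib_injl n_gt0 (i := i) (nu := nu)) => //; apply: remrP; exact: addrib_canrem h.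
Qed.

Lemma canrem_canadd mu i : canrem n mu i -> canadd n mu i = false.
Proof. by rewrite /canadd /canrem => /andP[/negbTE->]. Qed.

Implicit Types (f g : intpart -> R) (s : seq int).

(* The transposes of [1 + z u_i] and [1 + w d_i]: acting on functions instead of
   formal combinations of partitions avoids all sums. *)
Definition opX1 (z : R) (i : int) f : intpart -> R := fun mu =>
  f mu + if canadd n mu i then z * p ^+ nbeads n mu i * f (addr i mu) else 0.

Definition opY1 (w : R) (i : int) f : intpart -> R := fun la =>
  f la + if canrem n la i then w * p ^+ nbeads n la i * f (remr i la) else 0.

Definition opX z s f := foldr (opX1 z) f s.
Definition opY w s f := foldr (opY1 w) f s.

(** The diamonds show that the mixed terms of both sides exist together and end at the same
    partition; [addrib_nbeads_swap] matches their weights. *)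
Lemma opX1_Y1 z w i j f : i != j -> opX1 z i (opY1 w j f) = opY1 w j (opX1 z i f).
Proof.
move=> ne; apply/funext => mu; rewrite /opX1 /opY1.
have e : (canadd n mu i && canrem n (addr i mu) j) = (canrem n mu j && canadd n (remr j mu) i).
  apply/andP/andP => [[/addrP h1 /remrP h2]|[/remrP h1 /addrP h2]].
    have [al h3 h4] := addrib_diamond_dn n_gt0 ne h1 h2.
    split; first exact: addrib_canrem h3.
    by rewrite (remr_eq h3); exact: addrib_canadd h4.
  have [nu h3 h4] := addrib_diamond_up n_gt0 ne h1 h2.
  split; first exact: addrib_canadd h3.
  by rewrite (addr_eq h3); exact: addrib_canrem h4.
have [c|c] := boolP (canadd n mu i && canrem n (addr i mu) j); last first.
  have c' := c; rewrite e in c'.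
  case: (boolP (canadd n mu i)) c => /= [_ /negbTE->|_ _];
    case: (boolP (canrem n mu j)) c' => /= [_ /negbTE->|_ _]; ring.
have c' := c; rewrite e in c'.
move/andP: c => [ci cj']; move/andP: c' => [cj ci'].
rewrite ci cj' cj ci'.
have h1 := addrP ci; have h2 := remrP cj; have h3 := remrP cj'; have h4 := addrP ci'.
have eq2 : remr j (addr i mu) = addr i (remr j mu).
  by apply: rho_inj => k; have := h1 k; have := h2 k; have := h3 k; have := h4 k; lia.
rewrite eq2 in h3 *.
have ep := addrib_nbeads_swap n_gt0 ne h2 h4 h1 h3.
rewrite (addrib_nbeads n_gt0 h4) in ep.
have {}ep : p ^+ nbeads n mu i * p ^+ nbeads n (addr i mu) j =
          p ^+ nbeads n mu j * p ^+ nbeads n (remr j mu) i.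
  by rewrite -!exprD ep.
rewrite !mulrDr !addrA; congr (_ + _); first by ring.
by transitivity (z * w * (p ^+ nbeads n mu i * p ^+ nbeads n (addr i mu) j) * f (addr i (remr j mu)));
  [ring|rewrite ep; ring].
Qed.

Lemma opX_Y1 z w s j f : j \notin s -> opX z s (opY1 w j f) = opY1 w j (opX z s f).
Proof.
elim: s => //= i s IH; rewrite inE negb_or => /andP[ne js].
by rewrite IH // opX1_Y1 // eq_sym.
Qed.

Lemma opX1_Y z w s i f : i \notin s -> opX1 z i (opY w s f) = opY w s (opX1 z i f).
Proof.
elim: s => //= j s IH; rewrite inE negb_or => /andP[ne js].
by rewrite opX1_Y1 // IH.
Qed.

Definition window (mu : intpart) (i : int) : nat := (rho mu i - rho mu (i + n%:Z))%N.

Definition kfun (z w : R) (i : int) f : intpart -> R := fun mu =>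
  (\prod_(k < window mu i) (1 + z * w * p ^+ (2 * k))) * f mu.

(* The telescoping identity: conjugating by [kfun] turns the factor at [i] of
   one product of operators into the factor of the other. *)
Lemma kfunP z w (i : int) f :
  kfun z w (i + 1) (opX1 z i (opY1 w i f)) = opY1 w i (opX1 z i (kfun z w i f)).
Proof.
apply/funext => mu; rewrite /kfun /opX1 /opY1.
have E : i + 1 + n%:Z = i + n%:Z + 1 by lia.
have r1 := rho_step mu i; have r2 := rho_step mu (i + n%:Z).
have r3 := rhoDl mu (i + 1) n.-1.
have e3 : i + 1 + n.-1%:Z = i + n%:Z by lia.
rewrite e3 in r3.
pose P b := \prod_(k < b) (1 + z * w * p ^+ (2 * k)).
have PS b : P b.+1 = P b * (1 + z * w * p ^+ (2 * b)) by rewrite /P big_ord_recr.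
rewrite -!/(P _).
case: (boolP (canadd n mu i)) => [ca|nca]; last first.
  case: (boolP (canrem n mu i)) => [cr|ncr]; last first.
    have -> : window mu (i + 1) = window mu i; last by rewrite !addr0.
    by rewrite /window E; move: nca ncr; rewrite /canadd /canrem /bead; lia.
  have h := remrP cr; have ca := addrib_canadd n_gt0 h.
  have eb := addrib_nbeads n_gt0 h.
  rewrite ca (addr_eq h) -eb.
  set b := nbeads n mu i.
  have w1 : window mu (i + 1) = b.+1.
    by move: cr; rewrite /canrem /bead /b /nbeads /window E; lia.
  have w2 : window mu i = b.
    by move: cr; rewrite /canrem /bead /b /nbeads /window; lia.
  have w3 : window (remr i mu) i = b.+1.
    have := h i; have := h (i + n%:Z).
    by move: cr; rewrite /canrem /bead /b /nbeads /window; lia.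
  rewrite w1 w2 w3 PS mulnC exprM; ring.
have h := addrP ca; have cr := addrib_canrem n_gt0 h.
have ncr : canrem n mu i = false by apply/negbTE/negP => /canrem_canadd; rewrite ca.
have eb := addrib_nbeads n_gt0 h.
rewrite cr ncr (remr_eq h) eb.
set b := nbeads n mu i.
have w1 : window mu (i + 1) = b.
  by move: ca; rewrite /canadd /bead /b /nbeads /window E; lia.
have w2 : window mu i = b.+1.
  by move: ca; rewrite /canadd /bead /b /nbeads /window; lia.
have w3 : window (addr i mu) i = b.
  have := h i; have := h (i + n%:Z).
  by move: ca; rewrite /canadd /bead /b /nbeads /window; lia.
rewrite w1 w2 w3 PS mulnC exprM; ring.
Qed.

(* Listed in decreasing order, the order in which both operators process beads. *)
Fixpoint positions (lo : int) (m : nat) : seq int :=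
  if m is m'.+1 then lo + m'%:Z :: positions lo m' else [::].

Lemma mem_positions (lo : int) m (i : int) : (i \in positions lo m) = (lo <= i < lo + m%:Z).
Proof. by elim: m => [|m IH] /=; rewrite ?in_nil ?inE ?IH; lia. Qed.

(** The top [opY1] is commuted past the lower [opX1], exchanged with its partner by [kfunP], and
    after the induction hypothesis the top [opX1] is commuted past the lower [opY1]. *)
Lemma kfun_positions z w (lo : int) m f :
  kfun z w (lo + m%:Z) (opX z (positions lo m) (opY w (positions lo m) f)) =
  opY w (positions lo m) (opX z (positions lo m) (kfun z w lo f)).
Proof.
elim: m f => [|m IH] f; first by rewrite /= addr0.
have ni : lo + m%:Z \notin positions lo m by rewrite mem_positions; lia.
rewrite /= opX_Y1 //.
have -> : lo + m.+1%:Z = lo + m%:Z + 1 by lia.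
by rewrite kfunP IH opX1_Y.
Qed.

Definition scal (c : R) f : intpart -> R := fun mu => c * f mu.

Lemma opX_scal z s c f : opX z s (scal c f) = scal c (opX z s f).
Proof.
elim: s => //= i s ->; apply/funext => mu; rewrite /opX1 /scal.
by case: ifP => _; ring.
Qed.

Lemma opY_scal w s c f : opY w s (scal c f) = scal c (opY w s f).
Proof.
elim: s => //= i s ->; apply/funext => mu; rewrite /opY1 /scal.
by case: ifP => _; ring.
Qed.

Lemma opX_congr z s (k : int) f g mu : all (fun i => i + n%:Z < k) s -> rho mu k = 0%N ->
  (forall nu, rho nu k = 0%N -> f nu = g nu) -> opX z s f mu = opX z s g mu.
Proof.
elim: s mu => [|i s IH] mu /=; first by move=> _ h; exact.
move=> /andP[ik al] muk fg; rewrite /opX1 IH //; congr (_ + _).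
by case: ifP => // /addrP h; rewrite IH // h muk; lia.
Qed.

(** A vertical strip moves the right end by at most n: there is no bead to move at r or beyond, and
    a bead that jumps from below r lands below r+n, where the decreasing order does not return. *)
Lemma opX_positions_congr z (lo : int) m (r : int) f g mu : rho mu r = 0%N ->
  (forall nu, rho nu (r + n%:Z) = 0%N -> f nu = g nu) ->
  opX z (positions lo m) f mu = opX z (positions lo m) g mu.
Proof.
move=> mur fg; elim: m => [|m IH] /=.
  by apply: fg; have := rhoDl mu r n; lia.
have [le_r|lt_r] := lerP r (lo + m%:Z).
  rewrite /opX1 IH; have -> : canadd n mu (lo + m%:Z) = false; last by [].
  have [h _] := rho_mono mu le_r; have := rho_step mu (lo + m%:Z).
  by rewrite /canadd /bead; lia.
change (opX z (positions lo m.+1) f mu = opX z (positions lo m.+1) g mu).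
apply: (@opX_congr z _ (r + n%:Z)) => //.
  by apply/allP => i; rewrite inE => /predU1P[->|]; rewrite ?mem_positions; lia.
by have := rhoDl mu r n; lia.
Qed.

Lemma opY_congr w s (k : int) f g mu : rho mu k = 0%N ->
  (forall nu, rho nu k = 0%N -> f nu = g nu) -> opY w s f mu = opY w s g mu.
Proof.
elim: s mu => [|i s IH] mu /=; first by move=> h; exact.
move=> muk fg; rewrite /opY1 IH //; congr (_ + _).
by case: ifP => // /remrP h; rewrite IH //; have := h k; lia.
Qed.

(* A vertical strip may have arbitrarily many rows, so truncating the operators to
   finitely many positions is harmless only on functions supported on partitions
   with few rows, evaluated at partitions with few columns. *)
Definition full (k : int) (mu : intpart) := (rho mu k)%:Z == - k.
Definition supp_full (k : int) f := forall mu, ~~ full k mu -> f mu = 0.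

(** Since [rho mu k] exceeds -k by the number of holes below k, [full k] means that every position
    below k carries a bead. *)
Lemma full_le (k l : int) mu : l <= k -> full k mu -> full l mu.
Proof. by move=> le_lk; have [] := rho_mono mu le_lk; have := rho_ge mu l; rewrite /full; lia. Qed.

Lemma supp_full_le (k l : int) f : l <= k -> supp_full k f -> supp_full l f.
Proof. by move=> le_lk sf mu nf; apply: sf; apply: contra nf; exact: full_le. Qed.

Lemma opX_supp z s (k : int) f : supp_full k f -> supp_full k (opX z s f).
Proof.
move=> sf; elim: s => //= i s IH mu nf; rewrite /opX1 IH // add0r.
case: ifP => // /addrP h; rewrite IH ?mulr0 //.
by apply: contra nf; rewrite /full h; have := rho_ge mu k; lia.
Qed.

(** A removal at i leaves a hole at i+n < k, hence a partition outside the support. *)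
Lemma opY_supp_low w s (k : int) f : all (fun i => i + n%:Z < k) s -> supp_full k f -> opY w s f = f.
Proof.
move=> + sf; elim: s => //= i s IH /andP[ik al]; rewrite IH //.
apply/funext => mu; rewrite /opY1; case: ifP => [/remrP h|]; last by rewrite addr0.
rewrite (sf (remr i mu)) ?mulr0 ?addr0 //; apply/negP => fk.
have f1 : full (i + n%:Z) (remr i mu) by apply: full_le fk; lia.
have f2 : full (i + n%:Z + 1) (remr i mu) by apply: full_le fk; lia.
have := addrib_canadd n_gt0 h; rewrite /canadd /bead; move: f1 f2; rewrite /full; lia.
Qed.

(** Positions below k-n act trivially, and a ribbon added at a position i >= k-n does not change the
    profile at k-n. *)
Lemma opY_positions_supp w (lo : int) m (k : int) f : supp_full k f ->
  supp_full (k - n%:Z) (opY w (positions lo m) f).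
Proof.
move=> sf; elim: m => [|m IH]; first by apply: supp_full_le sf; lia.
have [lt|ge] := ltrP (lo + m%:Z + n%:Z) k.
  rewrite (@opY_supp_low w _ k) //; first by apply: supp_full_le sf; lia.
  by apply/allP => i; rewrite mem_positions; lia.
move=> mu nf /=; rewrite /opY1 IH // add0r; case: ifP => // /remrP h.
rewrite IH ?mulr0 //; apply: contra nf; rewrite /full => /eqP <-.
by have := h (k - n%:Z); lia.
Qed.

Definition kprod z w : R := \prod_(k < n) (1 + z * w * p ^+ (2 * k)).

(** Both ends of the telescoping become constants: the right window is empty at [mu], and the left
    window [lo, lo+n) is full on the support of [f]. *)
Lemma opX_opY z w (lo : int) m f mu : rho mu (lo + m%:Z) = 0%N ->
  supp_full (lo + n%:Z) f ->
  opX z (positions lo m) (opY w (positions lo m) f) mu =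
  kprod z w * opY w (positions lo m) (opX z (positions lo m) f) mu.
Proof.
move=> mu0 sf; have := congr1 (@^~ mu) (kfun_positions z w lo m f).
have -> : kfun z w lo f = scal (kprod z w) f.
  apply/funext => nu; rewrite /kfun /scal.
  case: (boolP (full (lo + n%:Z) nu)) => [fn|/sf ->]; last by rewrite !mulr0.
  have := full_le (l := lo) _ fn; move: fn; rewrite /full /window /kprod => fn h.
  by have -> : (rho nu lo - rho nu (lo + n%:Z) = n)%N by have := h (_ : lo <= _); lia.
rewrite opX_scal opY_scal /kfun /scal /window mu0 sub0n big_ord0 mul1r => ->.
by [].
Qed.

Section Truncation.
Variables (lo : int) (m : nat).
Local Notation s := (positions lo m).

Definition opXs (zs : seq R) f := foldr (fun z => opX z s) f zs.
Definition opYs (ws : seq R) f := foldr (fun w => opY w s) f ws.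

Lemma opXs_supp zs (k : int) f : supp_full k f -> supp_full k (opXs zs f).
Proof. by move=> sf; elim: zs => //= z zs IH; exact: opX_supp. Qed.

Lemma opYs_supp ws (k : int) f : supp_full k f -> supp_full (k - (n * size ws)%N%:Z) (opYs ws f).
Proof.
move=> sf; elim: ws => /= [|w ws IH]; first by rewrite muln0 subr0.
have -> : k - (n * (size ws).+1)%N%:Z = k - (n * size ws)%N%:Z - n%:Z by lia.
exact: opY_positions_supp.
Qed.

(** Every [opX] may push the rightmost bead n further before the exchange takes place, which is the
    reserve demanded of r. *)
Lemma opXs_opY zs w f mu (r : int) : rho mu r = 0%N ->
  r + (n * size zs)%N%:Z <= lo + m%:Z -> supp_full (lo + n%:Z) f ->
  opXs zs (opY w s f) mu = (\prod_(z <- zs) kprod z w) * opY w s (opXs zs f) mu.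
Proof.
elim: zs mu r => [|z zs IH] mu r mur le sf /=; first by rewrite big_nil mul1r.
rewrite (@opX_positions_congr z lo m r _ (scal (\prod_(z <- zs) kprod z w) (opY w s (opXs zs f)))) //.
  rewrite opX_scal /scal opX_opY //; last exact: opXs_supp.
    by rewrite big_cons mulrA [kprod _ _ * _]mulrC.
  by have [] := rho_mono mu (_ : r <= lo + m%:Z); lia.
by move=> nu nur; rewrite /scal; apply: (IH nu (r + n%:Z)) => //; move: le; rewrite /= mulnS; lia.
Qed.

(** Symmetrically, every [opY] already applied to [f] lowers its support by n, whence the reserve on
    the left. *)
Lemma opXs_opYs zs ws f mu (r : int) : rho mu r = 0%N ->
  r + (n * size zs)%N%:Z <= lo + m%:Z ->
  supp_full (lo + n%:Z + (n * size ws)%N%:Z) f ->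
  opXs zs (opYs ws f) mu =
  (\prod_(w <- ws) \prod_(z <- zs) kprod z w) * opYs ws (opXs zs f) mu.
Proof.
move=> mur le; elim: ws mu mur => [|w ws IH] mu mur sf /=; first by rewrite big_nil mul1r.
rewrite (opXs_opY _ mur) //; last first.
  have := @opYs_supp ws _ _ sf.
  have -> : lo + n%:Z + (n * size (w :: ws))%N%:Z - (n * size ws)%N%:Z = lo + n%:Z + n%:Z.
    by rewrite /= mulnS; lia.
  by apply: supp_full_le; lia.
rewrite (@opY_congr w _ r _ (scal (\prod_(w <- ws) \prod_(z <- zs) kprod z w)
     (opYs ws (opXs zs f)))) //.
  by rewrite opY_scal /scal big_cons mulrA.
move=> nu nur; rewrite /scal IH //; apply: supp_full_le sf.
by rewrite /= mulnS; lia.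
Qed.

Lemma opYs_irreducible ws f de : irreducible n de -> opYs ws f de = f de.
Proof.
move=> irr; elim: ws => //= w ws <-; elim: (positions lo m) => //= i s0 <-.
by rewrite /opY1; case: ifP => [/remrP/irr//|_]; rewrite addr0.
Qed.

Definition delta (la : intpart) : intpart -> R := fun mu => (mu == la)%:R.

(** Additions only raise the profile, so only the empty choice ends at [de]. The induction needs the
    vanishing at every partition that exceeds [de] somewhere. *)
Lemma opXs_delta zs de : opXs zs (delta de) de = 1.
Proof.
suff [] : opXs zs (delta de) de = 1 /\
    forall mu (k : int), (rho de k < rho mu k)%N -> opXs zs (delta de) mu = 0 by [].
elim: zs => [|z zs IH] /=.
  rewrite /delta eqxx; split=> // mu k lt; case: eqP => // e.
  by rewrite e ltnn in lt.
elim: (positions lo m) => //= i s0 [e1 e0]; split.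
  rewrite /opX1 e1; case: ifP => [/addrP h|_]; last by rewrite addr0.
  by rewrite (e0 _ (i + 1)) ?mulr0 ?addr0 // h; lia.
move=> mu k lt; rewrite /opX1 (e0 _ k) // add0r; case: ifP => // /addrP h.
by rewrite (e0 _ k) ?mulr0 // h; lia.
Qed.

Lemma truncated_cauchy zs ws de : irreducible n de ->
  (head 0%N de)%:Z + (n * size zs)%N%:Z <= lo + m%:Z ->
  lo + (n * (size ws).+1)%N%:Z <= - (size de)%:Z ->
  opXs zs (opYs ws (delta de)) de = \prod_(w <- ws) \prod_(z <- zs) kprod z w.
Proof.
move=> irr le1 le2; rewrite (@opXs_opYs zs ws _ _ (head 0%N de)%:Z) ?rho_big //.
  by rewrite opYs_irreducible // opXs_delta mulr1.
move=> mu nf; rewrite /delta; case: eqP => // e; case/negP: nf; rewrite e /full.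
by rewrite rho_small // -addrA; move: le2; rewrite mulnS; lia.
Qed.

End Truncation.
End Operators.

(** * Matrix elements of the operators *)

Section MatrixElements.
Variable n : nat.
Hypothesis n_gt0 : (0 < n)%N.

Lemma upath_gt J mu la t j (k : int) : upath n J mu la t -> j \in J ->
  j < k <= j + n%:Z -> (rho mu k < rho la k)%N.
Proof.
elim: J mu t => //= i J IH mu t [nu [t' [h pJ _]]]; rewrite inE => /predU1P[->|jJ] hk.
  by have := upath_le n_gt0 pJ k; rewrite h hk; lia.
by have := IH _ _ pJ jJ hk; rewrite h; lia.
Qed.

Lemma upath_stable_hi J mu la t (k : int) : upath n J mu la t ->
  all (fun j => j + n%:Z < k) J -> rho la k = rho mu k.
Proof.
elim: J mu t => [|i J IH] mu t /=; first by case=> ->.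
by case=> nu [t' [h pJ _]] /andP[ik al]; rewrite (IH _ _ pJ al) h; lia.
Qed.

Variables (R : comNzRingType) (p : R).

Lemma sorted_lt_rcons (J : seq int) j : sorted <%R (rcons J j) =
  all (fun i => i < j) J && sorted <%R J.
Proof. by rewrite !(sorted_pairwise lt_trans) pairwise_rcons. Qed.

Lemma sorted_gt_cons (J : seq int) j : sorted >%R (j :: J) =
  all (fun i => i < j) J && sorted >%R J.
Proof.
have gt_tr : transitive (>%R : rel int) by move=> a b c h1 h2; exact: lt_trans h2 h1.
by rewrite !(sorted_pairwise gt_tr).
Qed.

(** A matrix element is a single monomial: whether the top position i is used can be read off the
    profiles at i+n, so at most one of the two terms of [opY1] survives. *)
Lemma opY_delta_positions w mu (lo : int) m la :
  (forall J t, upath n J mu la t -> sorted <%R J -> {subset J <= positions lo m} ->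
     opY n p w (positions lo m) (delta R mu) la = w ^+ size J * p ^+ t) /\
  (opY n p w (positions lo m) (delta R mu) la != 0 ->
     exists J t, [/\ upath n J mu la t, sorted <%R J & {subset J <= positions lo m}]).
Proof.
elim: m la => [|m IH] la.
  split=> [[|j J] t|] /=.
  - by case=> -> ->; rewrite /delta eqxx mulr1.
  - by move=> _ _ /(_ j); rewrite mem_head => /(_ isT).
  - by rewrite /delta; case: (eqVneq la mu) => [-> _|]; rewrite ?eqxx //; exists [::], 0%N.
set i := lo + m%:Z; set f := opY n p w (positions lo m) (delta R mu).
have sub_lt J : {subset J <= positions lo m} -> all (fun j => j + n%:Z < i + n%:Z) J.
  by move=> sub; apply/allP => j /sub; rewrite (mem_positions n_gt0) /i; lia.
have stable nu : f nu != 0 -> rho nu (i + n%:Z) = rho mu (i + n%:Z).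
  by move=> /(IH nu).2[J [t [pJ _ /sub_lt al]]]; exact: (upath_stable_hi pJ al).
have opE : opY n p w (positions lo m.+1) (delta R mu) la =
   f la + if canrem n la i then w * p ^+ nbeads n la i * f (remr n i la) else 0 by [].
have subS J : {subset J <= positions lo m} -> {subset J <= positions lo m.+1}.
  by move=> sub j /sub; rewrite inE => ->; rewrite orbT.
split=> [J t|].
  have low : {subset J <= positions lo m} -> upath n J mu la t -> sorted <%R J ->
     opY n p w (positions lo m.+1) (delta R mu) la = w ^+ size J * p ^+ t.
    move=> sub pJ sJ; rewrite opE /f ((IH la).1 _ _ pJ sJ sub).
    case: ifP => [/(remrP n_gt0) h|]; last by rewrite addr0.
    suff -> : opY n p w (positions lo m) (delta R mu) (remr n i la) = 0 by rewrite mulr0 addr0.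
    apply/eqP; apply: contraT => /stable e.
    have := upath_stable_hi pJ (sub_lt _ sub); have := h (i + n%:Z); lia.
  case/lastP: J low => [|J j] low; first by move=> ? ? _; apply: low.
  move=> pJ sJ sub; have := sub j; rewrite mem_rcons mem_head inE => /(_ isT).
  move: sJ (sJ); rewrite {1}sorted_lt_rcons => /andP[al sJ'] sJ.
  have subJ : {subset J <= positions lo m}.
    move=> k kJ; have := allP al _ kJ; have := sub k; have := sub j.
    rewrite !mem_rcons mem_head !inE kJ orbT => /(_ isT) + /(_ isT).
    by rewrite !(mem_positions n_gt0); lia.
  case/predU1P => [ej|jm]; last first.
    by apply: low => // k; rewrite mem_rcons inE => /predU1P[->//|/subJ].
  rewrite -/i in ej; subst j.
  have [nu [t' [pJ' h ->]]] := (upath_rcons n J i mu la t).1 pJ.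
  rewrite opE (remr_eq n_gt0 h) (addrib_canrem n_gt0 h) /f ((IH nu).1 _ _ pJ' sJ' subJ).
  rewrite (addrib_nbeads n_gt0 h).
  have -> : opY n p w (positions lo m) (delta R mu) la = 0.
    apply/eqP; apply: contraT => /stable e.
    have := upath_stable_hi pJ' (sub_lt _ subJ); have := h (i + n%:Z); lia.
  by rewrite size_rcons exprS exprD; ring.
rewrite opE; have [f0|fn0 _] := eqVneq (f la) 0; last first.
  have [J [t [pJ sJ sub]]] := (IH la).2 fn0; exists J, t; split=> //; exact: subS.
rewrite f0 add0r; case: ifP; rewrite ?eqxx // => /(remrP n_gt0) h ne0.
have [|J [t [pJ sJ sub]]] := (IH (remr n i la)).2.
  by apply: contra ne0; rewrite -/f => /eqP ->; rewrite mulr0.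
exists (rcons J i), (t + nbeads n (remr n i la) i)%N; split.
- by apply/upath_rcons => //; exists (remr n i la), t.
- rewrite sorted_lt_rcons sJ andbT; apply/allP => j /sub; rewrite (mem_positions n_gt0) /i; lia.
- move=> j; rewrite mem_rcons inE => /predU1P[->|/sub]; first by rewrite inE eqxx.
  by rewrite inE => ->; rewrite orbT.
Qed.

(** The same argument with the top position as the first step of a decreasing path instead of the
    last step of an increasing one. *)
Lemma opX_delta_positions z la (lo : int) m mu :
  (forall J t, upath n J mu la t -> sorted >%R J -> {subset J <= positions lo m} ->
     opX n p z (positions lo m) (delta R la) mu = z ^+ size J * p ^+ t) /\
  (opX n p z (positions lo m) (delta R la) mu != 0 ->
     exists J t, [/\ upath n J mu la t, sorted >%R J & {subset J <= positions lo m}]).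
Proof.
elim: m mu => [|m IH] mu.
  split=> [[|j J] t|] /=.
  - by case=> -> ->; rewrite /delta eqxx mulr1.
  - by move=> _ _ /(_ j); rewrite mem_head => /(_ isT).
  - by rewrite /delta; case: (eqVneq mu la) => [-> _|]; rewrite ?eqxx //; exists [::], 0%N.
set i := lo + m%:Z; set f := opX n p z (positions lo m) (delta R la).
have sub_lt J : {subset J <= positions lo m} -> all (fun j => j + n%:Z < i + n%:Z) J.
  by move=> sub; apply/allP => j /sub; rewrite (mem_positions n_gt0) /i; lia.
have stable nu : f nu != 0 -> rho la (i + n%:Z) = rho nu (i + n%:Z).
  by move=> /(IH nu).2[J [t [pJ _ /sub_lt al]]]; exact: (upath_stable_hi pJ al).
have opE : opX n p z (positions lo m.+1) (delta R la) mu =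
   f mu + if canadd n mu i then z * p ^+ nbeads n mu i * f (addr n i mu) else 0 by [].
have subS J : {subset J <= positions lo m} -> {subset J <= positions lo m.+1}.
  by move=> sub j /sub; rewrite inE => ->; rewrite orbT.
split=> [J t|].
  have low : {subset J <= positions lo m} -> upath n J mu la t -> sorted >%R J ->
     opX n p z (positions lo m.+1) (delta R la) mu = z ^+ size J * p ^+ t.
    move=> sub pJ sJ; rewrite opE /f ((IH mu).1 _ _ pJ sJ sub).
    case: ifP => [/(addrP n_gt0) h|]; last by rewrite addr0.
    suff -> : opX n p z (positions lo m) (delta R la) (addr n i mu) = 0 by rewrite mulr0 addr0.
    apply/eqP; apply: contraT => /stable e.
    have := upath_stable_hi pJ (sub_lt _ sub); have := h (i + n%:Z); lia.
  case: J low => [|j J] low; first by move=> ? ? _; apply: low.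
  move=> pJ sJ sub; have := sub j; rewrite mem_head inE => /(_ isT).
  move: sJ (sJ); rewrite {1}sorted_gt_cons => /andP[al sJ'] sJ.
  have subJ : {subset J <= positions lo m}.
    move=> k kJ; have := allP al _ kJ; have := sub k; have := sub j.
    rewrite mem_head !inE kJ orbT => /(_ isT) + /(_ isT).
    by rewrite !(mem_positions n_gt0); lia.
  case/predU1P => [ej|jm]; last first.
    by apply: low => // k; rewrite inE => /predU1P[->//|/subJ].
  rewrite -/i in ej; subst j.
  case: pJ => nu [t' [h pJ' ->]].
  rewrite opE (addr_eq n_gt0 h) (addrib_canadd n_gt0 h) /f ((IH nu).1 _ _ pJ' sJ' subJ).
  have -> : opX n p z (positions lo m) (delta R la) mu = 0.
    apply/eqP; apply: contraT => /stable e.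
    have := upath_stable_hi pJ' (sub_lt _ subJ); have := h (i + n%:Z); lia.
  by rewrite /= exprS exprD; ring.
rewrite opE; have [f0|fn0 _] := eqVneq (f mu) 0; last first.
  have [J [t [pJ sJ sub]]] := (IH mu).2 fn0; exists J, t; split=> //; exact: subS.
rewrite f0 add0r; case: ifP; rewrite ?eqxx // => /(addrP n_gt0) h ne0.
have [|J [t [pJ sJ sub]]] := (IH (addr n i mu)).2.
  by apply: contra ne0; rewrite -/f => /eqP ->; rewrite mulr0.
exists (i :: J), (nbeads n mu i + t)%N; split.
- by exists (addr n i mu), t.
- rewrite sorted_gt_cons sJ andbT; apply/allP => j /sub; rewrite (mem_positions n_gt0) /i; lia.
- move=> j; rewrite inE => /predU1P[->|/sub]; first by rewrite inE eqxx.
  by rewrite inE => ->; rewrite orbT.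
Qed.
End MatrixElements.

(** * Partitions inside a square *)

Section BoxSet.
Variable M : nat.

(** No bead at or beyond M and no hole below -M: the diagram fits in an M by M square. *)
Definition box (mu : intpart) : bool := (rho mu M%:Z == 0%N) && (rho mu (- M%:Z) == M).

Lemma box_conj mu : box (conj_part mu) = box mu.
Proof.
have := rho_conj mu M%:Z; have := rho_conj mu (- M%:Z); rewrite opprK /box; lia.
Qed.

Lemma box_sizes (mu : intpart) : (size mu <= M)%N -> (head 0%N mu <= M)%N -> box mu.
Proof.
move=> h1 h2; rewrite /box rho_big ?lez_nat // eqxx /=.
by have := @rho_small mu (- M%:Z); lia.
Qed.

(** Enumerated through subsets of the square: each is sent to the partition with that diagram, or to
    the empty partition if there is none. *)
Definition box_set : {fset intpart} :=
  [fset mu in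
     [fset xget (Intpart (isT : is_part [::])) [set mu | diagram mu = D]%classic | D in
        fpowerset [fset u in [seq (r, c) | r <- iota 0 M, c <- iota 0 M]]%fset]%fset
   | box mu]%fset.

Lemma diagram_inj : injective diagram.
Proof.
move=> la mu e; apply: part_eq => r.
have aux c : (c < nth 0%N la r)%N = (c < nth 0%N mu r)%N.
  by rewrite -[LHS](mem_diagram la (r, c)) -[RHS](mem_diagram mu (r, c)) e.
have := aux (nth 0%N la r); have := aux (nth 0%N mu r); lia.
Qed.

Lemma mem_box_set mu : (mu \in box_set) = box mu.
Proof.
rewrite /box_set !inE /= andb_idl // => bmu; apply/imfsetP.
exists (diagram mu) => /=.
  rewrite fpowersetE; apply/fsubsetP => -[r c]; rewrite mem_diagram_rho /cont /= => h.
  rewrite in_fset /=.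
  apply/allpairsP; exists (r, c); rewrite !mem_iota /=; move: bmu => /andP[/eqP b1 /eqP b2].
  have [lt|ge] := ltrP (c%:Z - r%:Z) (- M%:Z).
    by have [_] := @rho_mono mu (c%:Z - r%:Z) (- M%:Z) (ltW lt); lia.
  have [] := @rho_mono mu _ _ ge; rewrite b2.
  have [lt'|ge'] := ltrP (c%:Z - r%:Z) M%:Z; last by have [] := @rho_mono mu _ _ ge'; lia.
  by have [_] := @rho_mono mu _ _ (ltW lt'); move=> *; split=> //; lia.
apply/esym; apply: xget_unique => // la; exact: diagram_inj.
Qed.

End BoxSet.

(** * Operators as finite matrices over the box *)

Section Box.
Variable n : nat.
Hypothesis n_gt0 : (0 < n)%N.
Variable M : nat.
Hypothesis le_nM : (n <= M)%N.

Local Notation box := (box M).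
Local Notation box_set := (box_set M).
(** The positions i with -M <= i and i+n < M: exactly the jumps that stay inside the box. *)
Local Notation s := (positions (- M%:Z) (M.*2 - n)).

Lemma addrib_box i mu nu : addrib n i mu nu -> i \in s -> box nu = box mu.
Proof. by move=> h; rewrite (mem_positions n_gt0) /box !h; lia. Qed.

Lemma upath_box J mu la t : upath n J mu la t -> box mu -> box la -> {subset J <= s}.
Proof.
move=> pJ /andP[_ /eqP mu0] /andP[/eqP la0 /eqP laM] j jJ; rewrite (mem_positions n_gt0).
have h1 := upath_gt n_gt0 pJ jJ (k := j + n%:Z) _.
have h2 := upath_gt n_gt0 pJ jJ (k := j + 1) _.
have [le1|lt1] := lerP M%:Z (j + n%:Z).
  by have [] := rho_mono la le1; have := h1 (_ : j < _ <= _); lia.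
have [le2|lt2] := lerP (j + 1) (- M%:Z); last by lia.
have [_] := rho_mono la le2; have := rho_ge mu (j + 1); have := h2 (_ : j < _ <= _); lia.
Qed.

Variables (R : comNzRingType).
Implicit Types (f : intpart -> R).

Section Sums.
Variable p : R.

Lemma sum_delta f mu : box mu -> f mu = \sum_(la <- box_set) delta R la mu * f la.
Proof.
move=> bmu; rewrite (big_fsetD1 mu) ?mem_box_set //= /delta eqxx mul1r big1_fset ?addr0 //.
by move=> la; rewrite in_fsetD1 eq_sym => /andP[/negbTE -> _] _; rewrite mul0r.
Qed.

(** Jumps at positions of [s] preserve the box, so at a box partition only the values of [f] on the
    box matter. *)
Lemma opX_sum z f mu : box mu ->
  opX n p z s f mu = \sum_(la <- box_set) opX n p z s (delta R la) mu * f la.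
Proof.
have : {subset s <= s} by [].
elim: {1 3 4} s mu => [|i s0 IH] mu sub bmu; first exact: sum_delta.
have sub0 : {subset s0 <= s} by move=> j js; apply: sub; rewrite inE js orbT.
rewrite /= -!/(opX _ _ _ _ _) {1}/opX1 IH //.
under [RHS]eq_bigr do rewrite /opX1 mulrDl.
rewrite big_split /=; congr (_ + _).
case: ifP => [/(addrP n_gt0) h|_]; last by rewrite big1 // => la _; rewrite mul0r.
rewrite IH // ?(addrib_box h) ?sub ?mem_head // mulr_sumr.
by apply: eq_bigr => la _; rewrite mulrA.
Qed.

Lemma opY_sum w f mu : box mu ->
  opY n p w s f mu = \sum_(la <- box_set) opY n p w s (delta R la) mu * f la.
Proof.
have : {subset s <= s} by [].
elim: {1 3 4} s mu => [|i s0 IH] mu sub bmu; first exact: sum_delta.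
have sub0 : {subset s0 <= s} by move=> j js; apply: sub; rewrite inE js orbT.
rewrite /= -!/(opY _ _ _ _ _) {1}/opY1 IH //.
under [RHS]eq_bigr do rewrite /opY1 mulrDl.
rewrite big_split /=; congr (_ + _).
case: ifP => [/(remrP n_gt0) h|_]; last by rewrite big1 // => la _; rewrite mul0r.
rewrite IH // -?(addrib_box h) ?sub ?mem_head // mulr_sumr.
by apply: eq_bigr => la _; rewrite mulrA.
Qed.

Local Notation opXs := (opXs n p (- M%:Z) (M.*2 - n)).
Local Notation opYs := (opYs n p (- M%:Z) (M.*2 - n)).

Lemma opXs_sum zs f mu : box mu ->
  opXs zs f mu = \sum_(la <- box_set) opXs zs (delta R la) mu * f la.
Proof.
elim: zs mu => [|z zs IH] mu bmu; first exact: sum_delta.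
rewrite /= opX_sum // (eq_big_seq (fun nu => \sum_(la <- box_set)
   opX n p z s (delta R nu) mu * opXs zs (delta R la) nu * f la)); last first.
  move=> nu; rewrite mem_box_set => bnu; rewrite IH // mulr_sumr.
  by apply: eq_bigr => la _; rewrite mulrA.
rewrite exchange_big /=; apply: eq_bigr => la _.
by rewrite -mulr_suml -opX_sum.
Qed.

Lemma opYs_sum ws f mu : box mu ->
  opYs ws f mu = \sum_(la <- box_set) opYs ws (delta R la) mu * f la.
Proof.
elim: ws mu => [|w ws IH] mu bmu; first exact: sum_delta.
rewrite /= opY_sum // (eq_big_seq (fun nu => \sum_(la <- box_set)
   opY n p w s (delta R nu) mu * opYs ws (delta R la) nu * f la)); last first.
  move=> nu; rewrite mem_box_set => bnu; rewrite IH // mulr_sumr.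
  by apply: eq_bigr => la _; rewrite mulrA.
rewrite exchange_big /=; apply: eq_bigr => la _.
by rewrite -mulr_suml -opY_sum.
Qed.

End Sums.

Definition nribbons (mu la : intpart) : nat := #|` strip_ribbons n la mu|.
Definition strip_spin (mu la : intpart) : nat := (\sum_(S <- strip_ribbons n la mu) spin S)%N.

Definition hwt (q x : R) (mu la : intpart) : R :=
  if `[< is_horizontal_strip n la mu >]
  then x ^+ nribbons mu la * q ^+ strip_spin mu la else 0.

Lemma hwt_upath q x J mu la t : upath n J mu la t -> sorted <%R J ->
  hwt q x mu la = x ^+ size J * q ^+ t.
Proof.
move=> pJ sJ; have [e1 e2] := strip_ribbons_upath n_gt0 pJ sJ.
rewrite /hwt asboolT; first by rewrite /nribbons /strip_spin e1 e2.
by apply/(hstripP n_gt0); exists J, t.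
Qed.

Lemma opY_delta p w mu la : box mu -> box la -> opY n p w s (delta R mu) la = hwt p w mu la.
Proof.
move=> bmu bla; have [h1 h2] := opY_delta_positions n_gt0 p w mu (- M%:Z) (M.*2 - n) la.
have [/(hstripP n_gt0)[J [t [pJ sJ]]]|no] := pselect (is_horizontal_strip n la mu).
  rewrite (h1 J t) //; first by rewrite (hwt_upath p w pJ sJ).
  exact: upath_box pJ bmu bla.
rewrite /hwt asboolF //; apply/eqP; apply: contraT => /h2[J [t [pJ sJ _]]].
by case: no; apply/(hstripP n_gt0); exists J, t.
Qed.

Lemma sorted_map_conjpos J : sorted >%R (map (conjpos n) J) = sorted <%R J.
Proof.
by rewrite sorted_map; apply: eq_sorted => i j /=; rewrite /conjpos; lia.
Qed.

(* Conjugation exchanges beads and holes, so a ribbon of spin s becomes one of spin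
   n-1-s; the scaling of the variable by q^(n-1) absorbs the difference. *)
Lemma opX_delta p q x mu la : p * q = 1 -> box mu -> box la ->
  opX n p (x * q ^+ n.-1) s (delta R la) mu = hwt q x (conj_part mu) (conj_part la).
Proof.
move=> pq1 bmu bla.
have [h1 h2] := opX_delta_positions n_gt0 p (x * q ^+ n.-1) la (- M%:Z) (M.*2 - n) mu.
have [/(hstripP n_gt0)[J [t [pJ sJ]]]|no] := pselect (is_horizontal_strip n (conj_part la) (conj_part mu)).
  rewrite (hwt_upath q x pJ sJ).
  have [t' pJ' et] := upath_conj n_gt0 pJ; rewrite !conj_partK in pJ'.
  rewrite (h1 _ _ pJ') ?sorted_map_conjpos ?size_map //; last exact: upath_box pJ' bmu bla.
  (* For l ribbons, (x q^(n-1))^l p^t' = x^l q^t because t + t' = (n-1) l and p q = 1. *)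
  rewrite exprMn -mulrA -exprM -et addnC exprD -[_ * _ * p ^+ t']mulrA; congr (_ * _).
  by rewrite -exprMn mulrC [q * p]mulrC pq1 expr1n mul1r.
rewrite /hwt asboolF //; apply/eqP; apply: contraT => /h2[J [t [pJ sJ _]]].
case: no; apply/(hstripP n_gt0); have [t' pJ' _] := upath_conj n_gt0 pJ.
exists (map (conjpos n) J), t'; split=> //.
by rewrite -sorted_map_conjpos -map_comp (eq_map (conjposK n_gt0)) map_id.
Qed.

Fixpoint hsum (q : R) (xs : seq R) (mu la : intpart) : R :=
  if xs is x :: xs' then \sum_(nu <- box_set) hwt q x mu nu * hsum q xs' nu la
  else (mu == la)%:R.

Lemma big_box_conj (F : intpart -> R) :
  \sum_(la <- box_set) F la = \sum_(la <- box_set) F (conj_part la).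
Proof.
rewrite -(big_map conj_part xpredT F); apply: perm_big; apply: uniq_perm => //.
  by rewrite map_inj_uniq ?fset_uniq //; exact: can_inj conj_partK.
move=> la; rewrite mem_box_set; apply/idP/mapP => [bla|[mu]].
  by exists (conj_part la); rewrite ?conj_partK ?mem_box_set ?box_conj.
by rewrite mem_box_set => bmu ->; rewrite box_conj.
Qed.

Lemma opXs_hsum p q xs mu la : p * q = 1 -> box mu -> box la ->
  opXs n p (- M%:Z) (M.*2 - n) [seq x * q ^+ n.-1 | x <- xs] (delta R la) mu =
  hsum q xs (conj_part mu) (conj_part la).
Proof.
move=> pq1 + bla; elim: xs mu => [|x xs IH] mu bmu /=.
  by rewrite /delta (can_eq conj_partK).
rewrite opX_sum // [RHS]big_box_conj; apply: eq_big_seq => nu; rewrite mem_box_set => bnu.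
by rewrite opX_delta // IH.
Qed.

(** The outermost [opY] removes the last strip of a chain, hence the reversal. *)
Lemma opYs_hsum p ws mu la : box mu -> box la ->
  opYs n p (- M%:Z) (M.*2 - n) (rev ws) (delta R mu) la = hsum p ws mu la.
Proof.
move=> + bla; elim: ws mu => [|w ws IH] mu bmu; first by rewrite /= /delta eq_sym.
rewrite rev_cons /opYs foldr_rcons -/(opYs _ _ _ _ _ _) opYs_sum //=.
apply: eq_big_seq => nu; rewrite mem_box_set => bnu.
by rewrite IH // opY_delta // mulrC.
Qed.

Lemma box_cauchy (p q : R) xs ys de : p * q = 1 -> irreducible n de ->
  (head 0%N de + n * (size xs).+1 <= M)%N ->
  (size de + n * (size ys).+1 <= M)%N ->
  \sum_(la <- box_set) hsum q xs (conj_part de) (conj_part la) *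
     hsum p [seq y * q ^+ n.-1 | y <- ys] de la =
  \prod_(y <- ys) \prod_(x <- xs) \prod_(k < n) (1 + x * y * q ^+ (2 * k)).
Proof.
move=> pq1 irr le1 le2.
have bde : box de by apply: box_sizes; lia.
have := @truncated_cauchy n n_gt0 R p (- M%:Z) (M.*2 - n) [seq x * q ^+ n.-1 | x <- xs]
  (rev [seq y * q ^+ n.-1 | y <- ys]) de irr.
rewrite size_rev !size_map mulnS => h.
rewrite mulnS in le1; rewrite mulnS in le2.
have {h} := h _ _; rewrite opXs_sum // => h.
transitivity (\sum_(la <- box_set)
   opXs n p (- M%:Z) (M.*2 - n) [seq x * q ^+ n.-1 | x <- xs] (delta R la) de *
   opYs n p (- M%:Z) (M.*2 - n) (rev [seq y * q ^+ n.-1 | y <- ys]) (delta R de) la).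
  by apply: eq_big_seq => la; rewrite mem_box_set => bla; rewrite (opXs_hsum _ pq1) // opYs_hsum.
have ex : @size (GRing.PzSemiRing.sort R) xs = @size R xs by [].
have ey : @size (GRing.PzSemiRing.sort R) ys = @size R ys by [].
rewrite h; [|lia|lia].
rewrite (perm_big [seq y * q ^+ n.-1 | y <- ys]) ?perm_rev //= big_map.
apply: eq_bigr => y _; rewrite big_map; apply: eq_bigr => x _.
(* Replacing k by n-1-k turns q^(2(n-1)) p^(2k) into q^(2k). *)
rewrite /kprod (reindex_inj rev_ord_inj) /=; apply: eq_bigr => k _; congr (1 + _).
have -> : (2 * (n - k.+1) = (n.-1 - k) * 2)%N by have := ltn_ord k; lia.
have {1 2}-> : n.-1 = (n.-1 - k + k)%N by have := ltn_ord k; lia.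
rewrite exprD [(2 * k)%N]mulnC !exprM.
have : p ^+ (n.-1 - k) * q ^+ (n.-1 - k) = 1 by rewrite -exprMn pq1 expr1n.
rewrite !expr2; move: (p ^+ _) (q ^+ _) (q ^+ k) => a b c ab.
transitivity (x * y * (c * c) * (a * b) * (a * b)); [ring|].
by rewrite ab !mulr1.
Qed.

End Box.

(** * Ribbon functions as coefficients *)

Lemma size_le_card_diagram (mu : intpart) : (size mu <= #|` diagram mu|)%N.
Proof.
have <- : #|` [fset u in [seq (r, 0%N) | r <- iota 0 (size mu)]]%fset| = size mu.
  rewrite card_fseq undup_id ?size_map ?size_iota // map_inj_uniq ?iota_uniq //.
  by move=> i j [].
apply: fsubset_leq_card; apply/fsubsetP => u; rewrite in_fset /= => /mapP[r].
by rewrite mem_iota => /andP[_ h] ->; rewrite mem_diagram /=; exact: part_nth_gt0.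
Qed.

Lemma head_le_card_diagram (mu : intpart) : (head 0%N mu <= #|` diagram mu|)%N.
Proof.
have <- : #|` [fset u in [seq (0%N, c) | c <- iota 0 (head 0%N mu)]]%fset| = head 0%N mu.
  rewrite card_fseq undup_id ?size_map ?size_iota // map_inj_uniq ?iota_uniq //.
  by move=> i j [].
apply: fsubset_leq_card; apply/fsubsetP => u; rewrite in_fset /= => /mapP[r].
by rewrite mem_iota => /andP[_ h] ->; rewrite mem_diagram /= nth0.
Qed.

Section Tableaux.
Variable n : nat.
Hypothesis n_gt0 : (0 < n)%N.

Definition hstrip (mu la : intpart) : bool := `[< is_horizontal_strip n la mu >].
Definition weights (mu : intpart) (c : seq intpart) := pairmap (nribbons n) mu c.
Definition total_spin (mu : intpart) (c : seq intpart) := sumn (pairmap (strip_spin n) mu c).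

Lemma hstripE mu la : hstrip mu la -> exists J t,
  [/\ upath n J mu la t, sorted <%R J, nribbons n mu la = size J & strip_spin n mu la = t].
Proof.
move=> /asboolP/(hstripP n_gt0)[J [t [pJ sJ]]]; exists J, t.
by have [e1 e2] := strip_ribbons_upath n_gt0 pJ sJ.
Qed.

Lemma hstrip_refl mu : hstrip mu mu.
Proof. by apply/asboolP/(hstripP n_gt0); exists [::], 0%N. Qed.

Lemma nribbons_refl mu : nribbons n mu mu = 0%N.
Proof. by rewrite /nribbons; have [-> _] := @strip_ribbons_upath n n_gt0 [::] mu mu 0%N (conj erefl erefl) isT. Qed.

Lemma strip_spin_refl mu : strip_spin n mu mu = 0%N.
Proof. by rewrite /strip_spin; have [_ ->] := @strip_ribbons_upath n n_gt0 [::] mu mu 0%N (conj erefl erefl) isT. Qed.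

Lemma nribbons_gt0 mu la : hstrip mu la -> mu != la -> (0 < nribbons n mu la)%N.
Proof.
move=> /hstripE[[|i J] [t [pJ _ -> _]]] //=.
by case: pJ => ->; rewrite eqxx.
Qed.

Lemma path_card mu c : path hstrip mu c ->
  #|` diagram (last mu c)| = (#|` diagram mu| + n * sumn (weights mu c))%N.
Proof.
elim: c mu => [|nu c IH] mu /=; first by rewrite muln0 addn0.
move=> /andP[/hstripE[J [t [pJ _ e _]]] /IH ->].
by rewrite (card_diagram_upath n_gt0 pJ) e mulnDr addnA.
Qed.

Lemma path_card_le mu c : path hstrip mu c ->
  all (fun nu => #|` diagram nu| <= #|` diagram (last mu c)|)%N c.
Proof.
elim: c mu => [|nu c IH] mu //= /andP[_ pc]; rewrite IH // andbT.
by rewrite (path_card pc) leq_addr.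
Qed.

Lemma path_ncore mu c : path hstrip mu c -> ncore n (last mu c) = ncore n mu.
Proof.
elim: c mu => [|nu c IH] mu //= /andP[/hstripE[J [t [pJ _ _ _]]] /IH ->].
exact: (ncore_upath n_gt0 pJ).
Qed.

Lemma tableau_pathP la mu c : is_ribbon_tableau n la mu c <->
  [/\ path hstrip mu c, last mu c = la &
      c != [::] -> chain_nth mu c (size c).-1 != la].
Proof.
split=> -[h1 h2 h3]; split=> //.
  by apply/(pathP (last mu c)) => i /h1 h; apply/asboolP; exact: h.
by move=> i lti; have /(pathP (last mu c))/(_ i lti)/asboolP := h1.
Qed.

Lemma nth_chain mu c i : (size c <= i)%N -> chain_nth mu c i = last mu c.
Proof.
rewrite leq_eqVlt /chain_nth => /predU1P[<-|lt]; last by rewrite nth_default.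
by rewrite -last_nth.
Qed.

Lemma card_tableau_ribbons mu c i :
  #|` tableau_ribbons n mu c i| = nth 0%N (weights mu c) i.
Proof.
have [lt|le] := ltnP i (size c).
  by rewrite /weights (nth_pairmap (last mu c)).
rewrite nth_default ?size_pairmap // /tableau_ribbons !nth_chain // ?leqW //.
exact: nribbons_refl.
Qed.

Lemma tableau_spinE mu c : tableau_spin n mu c = total_spin mu c.
Proof.
rewrite /tableau_spin /total_spin sumnE (big_nth 0%N) size_pairmap big_mkord.
apply: eq_bigr => i _; rewrite (nth_pairmap (last mu c)) //.
Qed.

(* Padding by empty strips identifies the trimmed chains of [is_ribbon_tableau]
   with the chains of length r. *)
Definition pad (r : nat) (la : intpart) (c : seq intpart) := c ++ nseq (r - size c) la.

Lemma size_pad r la c : (size c <= r)%N -> size (pad r la c) = r.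
Proof. by move=> le; rewrite size_cat size_nseq subnKC. Qed.

Lemma pairmap_nseq (T : Type) (f : intpart -> intpart -> T) k la :
  pairmap f la (nseq k la) = nseq k (f la la).
Proof. by elim: k => //= k ->. Qed.

Lemma last_nseq k (la : intpart) : last la (nseq k la) = la.
Proof. by elim: k => //= k. Qed.

Lemma last_pad r la mu c : last mu c = la -> last mu (pad r la c) = la.
Proof. by move=> e; rewrite last_cat e last_nseq. Qed.

Lemma total_spin_pad r la mu c : last mu c = la -> total_spin mu (pad r la c) = total_spin mu c.
Proof.
move=> e; rewrite /total_spin pairmap_cat e pairmap_nseq strip_spin_refl sumn_cat.
by rewrite sumn_nseq mul0n addn0.
Qed.

Lemma nth_weights_pad r la mu c i : last mu c = la ->
  nth 0%N (weights mu (pad r la c)) i = nth 0%N (weights mu c) i.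
Proof.
move=> e; rewrite /weights pairmap_cat e pairmap_nseq nribbons_refl nth_cat.
by case: ltnP => // le; rewrite nth_nseq if_same nth_default.
Qed.

Lemma path_pad r la mu c : last mu c = la -> path hstrip mu (pad r la c) = path hstrip mu c.
Proof.
move=> e; rewrite cat_path e; apply: andb_idr => _.
by elim: (r - _)%N => //= k ->; rewrite hstrip_refl.
Qed.

Lemma pad_surj la mu d : last mu d = la -> exists c,
  [/\ (size c <= size d)%N, d = pad (size d) la c, last mu c = la &
      c != [::] -> chain_nth mu c (size c).-1 != la].
Proof.
elim/last_ind: d => [|d x IH] /=; first by move=> e; exists [::].
rewrite last_rcons => ->; have [e|ne] := eqVneq (last mu d) la.
  have [c [sz ed lc tr]] := IH e; exists c; split=> //; first by rewrite size_rcons leqW.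
  by rewrite {1}ed /pad size_rcons subSn // rcons_cat -cats1 -[[:: la]]/(nseq 1 la) -nseqD addn1.
exists (rcons d la); split=> //; first by rewrite /pad subnn cats0.
  by rewrite last_rcons.
rewrite size_rcons /= /chain_nth -rcons_cons nth_rcons /= ltnSn => _.
by rewrite -last_nth.
Qed.

(** The longer chain is the shorter one followed by copies of [la]; a single copy would contradict
    trimming. *)
Lemma pad_inj r la mu c c' : (size c <= r)%N -> (size c' <= r)%N ->
  last mu c = la -> last mu c' = la ->
  (c != [::] -> chain_nth mu c (size c).-1 != la) ->
  (c' != [::] -> chain_nth mu c' (size c').-1 != la) ->
  pad r la c = pad r la c' -> c = c'.
Proof.
suff aux (d d' : seq intpart) : (size d <= size d')%N -> (size d' <= r)%N -> last mu d = la ->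
    (d' != [::] -> chain_nth mu d' (size d').-1 != la) ->
    pad r la d = pad r la d' -> d = d'.
  move=> s s' l l' t t' e; have [le|lt] := leqP (size c) (size c'); first exact: aux e.
  by apply/esym; apply: aux (esym e) => //; exact: ltnW.
move=> le ler ld tr e.
have ed' : d' = d ++ nseq (size d' - size d) la.
  have := congr1 (take (size d')) e; rewrite {2}/pad take_size_cat // => e2.
  rewrite -[LHS]e2 /pad take_cat ltnNge le /=; congr cat.
  by rewrite take_nseq // leq_sub2r.
move: ed' tr; set j := (size d' - size d)%N; case: j => [|j] ed' tr; first by rewrite ed' cats0.
have szd : (size d').-1 = (size d + j)%N by rewrite ed' size_cat size_nseq addnS.
have : d' != [::] by rewrite ed'; case: (d).
move=> /tr; rewrite szd /chain_nth ed' -cat_cons nth_cat /= ltnS.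
case: ltnP => [h|h].
  rewrite -[la :: nseq j la]/(nseq j.+1 la) nth_nseq ifT ?eqxx //.
  by rewrite subnS -addnBAC // subnn add0n (leq_ltn_trans (leq_pred j)).
have -> : j = 0%N by apply/eqP; rewrite -leqn0 -(leq_add2l (size d)) addn0.
by rewrite addn0 -last_nth ld eqxx.
Qed.

Variable M : nat.

Fixpoint paths (r : nat) : seq (seq intpart) :=
  if r is r'.+1 then [seq nu :: c | nu <- box_set M, c <- paths r'] else [:: [::]].

Lemma mem_paths r c : (c \in paths r) = (size c == r) && all (box M) c.
Proof.
elim: r c => [|r IH] [|nu c] //=.
  by apply/allpairsP => -[[x y] []].
apply/allpairsP/idP => [[[x y] /= [xb yp [-> ->]]]|].
  by rewrite eqSS; move: yp; rewrite IH mem_box_set in xb * => /andP[-> ->]; rewrite xb.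
rewrite eqSS => /and3P[sz bnu bc]; exists (nu, c); split=> //=; first by rewrite mem_box_set.
by rewrite IH sz.
Qed.

Lemma uniq_paths r : uniq (paths r).
Proof.
elim: r => //= r IH; apply: allpairs_uniq; rewrite ?fset_uniq // => -[x y] [x' y'] _ _ /=.
by case=> -> ->.
Qed.

Definition fits (r : nat) (a : nat -> nat) (ws : seq nat) : bool :=
  all (fun i => nth 0%N ws i == a i) (iota 0 r).

Lemma sumn_fits r a ws : size ws = r -> fits r a ws -> sumn ws = (\sum_(i < r) a i)%N.
Proof.
move=> sz /allP f; rewrite sumnE (big_nth 0%N) sz big_mkord; apply: eq_bigr => i _.
by apply/eqP/f; rewrite mem_iota /=.
Qed.

Section Tau.
Variable R : comNzRingType.

Definition tau (q : R) (r : nat) (mu la : intpart) (a : nat -> nat) : R :=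
  \sum_(c <- paths r | [&& path hstrip mu c, last mu c == la & fits r a (weights mu c)])
     q ^+ total_spin mu c.

Definition weight_sum (r : nat) (a : nat -> nat) : nat := \sum_(i < r) a i.

(** The last strip of a trimmed chain is nonempty, so the variable of its index occurs in [a]. *)
Lemma tableau_size (mu la : intpart) c (a : {cmonom nat}) r :
  (forall i, (r <= i)%N -> a i = 0%N) ->
  is_ribbon_tableau n la mu c -> has_weight n mu c a -> (size c <= r)%N.
Proof.
move=> sa /tableau_pathP[pc lc tr] wc; rewrite leqNgt; apply/negP => lt.
have cn : c != [::] by case: (c) lt.
have [i szi] : exists i, size c = i.+1 by case: (c) lt => //= x c' _; exists (size c').
have a0 : a i = 0%N by clear - sa lt szi; apply: sa; rewrite szi ltnS in lt.
have := tr cn; rewrite szi /= => ne.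
have /(pathP (last mu c))/(_ i) := pc; rewrite szi => /(_ (ltnSn i)) hs.
have := nribbons_gt0 hs; rewrite -/(chain_nth mu c i).
have e : nth (last mu c) c i = la.
  by have := nth_chain mu (leqnn (size c)); rewrite [X in chain_nth _ _ X]szi /chain_nth /= => ->.
rewrite e => /(_ ne).
have := etrans (wc i) a0; rewrite card_tableau_ribbons (nth_pairmap (last mu c)) ?szi // e -/(chain_nth mu c i).
by move=> ->; rewrite ltnn.
Qed.

(** Padding is the bijection onto chains of r steps. All partitions of such a chain have at most as
    many squares as the last one, whose size the weight fixes, so M encloses them. *)
Lemma ribbon_function_tau (q : R) (mu la : intpart) (a : {cmonom nat}) r :
  (forall i, (r <= i)%N -> a i = 0%N) ->
  (#|` diagram mu| + n * weight_sum r a <= M)%N ->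
  ribbon_function n q la mu a = tau q r mu la a.
Proof.
move=> sa leM; rewrite /ribbon_function.
pose ok c := [&& path hstrip mu c, last mu c == la & fits r a (weights mu c)].
pose Q := [seq c <- paths r | ok c].
have bij : set_bij [set c | is_ribbon_tableau n la mu c /\ has_weight n mu c a]%classic
    [set` Q]%classic (pad r la).
  split.
  - move=> c [/[dup] tc /tableau_pathP[pc lc tr] wc]; rewrite /= /Q mem_filter mem_paths.
    have sz := tableau_size sa tc wc.
    have okc : ok (pad r la c).
      rewrite /ok path_pad // pc last_pad // eqxx /=; apply/allP => i _.
      by rewrite nth_weights_pad // -card_tableau_ribbons wc.
    rewrite okc size_pad // eqxx /=.
    case/and3P: okc => pp /eqP lp fp.
    have szw : size (weights mu (pad r la c)) = r by rewrite size_pairmap size_pad.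
    have := path_card_le pp; rewrite path_card // (sumn_fits szw fp) => /allP le.
    apply/allP => nu /le h; apply: box_sizes; apply: leq_trans leM; apply: leq_trans h.
      exact: size_le_card_diagram.
    exact: head_le_card_diagram.
  - move=> c c'; rewrite !inE => -[/[dup] tc /tableau_pathP[pc lc tr] wc].
    move=> [/[dup] tc' /tableau_pathP[pc' lc' tr'] wc'].
    by apply: pad_inj tr tr' => //; [exact: tableau_size tc wc|exact: tableau_size tc' wc'].
  - move=> d; rewrite /= /Q mem_filter mem_paths => /andP[/and3P[pd /eqP ld fd] /andP[/eqP szd _]].
    have [c [szc ed lc tr]] := pad_surj ld; rewrite szd in szc ed.
    exists c => //; split.
      by apply/tableau_pathP; split=> //; rewrite -(path_pad r lc) -ed.
    move=> i; rewrite card_tableau_ribbons -(nth_weights_pad r _ lc) -ed.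
    have [lt|le] := ltnP i r; last by rewrite sa // nth_default // size_pairmap szd.
    by have /allP/(_ i) := fd; rewrite mem_iota lt => /(_ isT)/eqP.
transitivity (\sum_(d \in [set` Q]%classic) q ^+ total_spin mu d).
  rewrite (@reindex_fsbig _ _ _ _ _ (pad r la) _ _ _ bij); apply: eq_fsbigr => c; rewrite in_setE => -[/tableau_pathP[_ lc _] _].
  by rewrite tableau_spinE total_spin_pad.
by rewrite -fsbig_seq ?filter_uniq ?uniq_paths // /Q big_filter.
Qed.

Lemma tau_ncore q r mu la a : tau q r mu la a != 0 -> ncore n la = ncore n mu.
Proof.
move=> ne; have [c /and3P[pc /eqP lc _]] : exists c, [&& path hstrip mu c, last mu c == la & fits r a (weights mu c)].
  apply/not_existsP => no; case/eqP: ne; rewrite /tau big1_seq // => c /andP[h _].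
  by case: (no c).
by rewrite -lc path_ncore.
Qed.

Lemma tau_card q r mu la a : tau q r mu la a != 0 ->
  #|` diagram la| = (#|` diagram mu| + n * weight_sum r a)%N.
Proof.
move=> ne; have [c /andP[cp /and3P[pc /eqP lc fc]]] : exists c, (c \in paths r) &&
   [&& path hstrip mu c, last mu c == la & fits r a (weights mu c)].
  apply/not_existsP => no; case/eqP: ne; rewrite /tau big1_seq // => c /andP[h h'].
  by case: (no c); rewrite h h'.
rewrite -{1}lc path_card // (sumn_fits _ fc) // size_pairmap.
by move: cp; rewrite mem_paths => /andP[/eqP].
Qed.

Fixpoint mon (k : nat) (ws : seq nat) : {cmonom nat} :=
  if ws is w :: ws' then iter w (mulcm (ucm k)) (mon k.+1 ws') else onecm nat.

Lemma monE k ws i : mon k ws i = if (k <= i)%N then nth 0%N ws (i - k) else 0%N.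
Proof.
elim: ws k => [|w ws IH] k /=; first by rewrite onecmE nth_nil if_same.
have -> : iter w (mulcm (ucm k)) (mon k.+1 ws) i = (w * (k == i) + mon k.+1 ws i)%N.
  by elim: w => //= w IHw; rewrite mulcmE IHw ucmE mulSn addnA.
rewrite IH; case: ltngtP => [lt|lt|->]; rewrite ?muln0 //.
  by rewrite add0n -[(i - k)%N]prednK ?subn_gt0 //= -subnS.
by rewrite muln1 subnn addn0.
Qed.

Lemma mon_fits r ws (a : {cmonom nat}) : (forall i, (r <= i)%N -> a i = 0%N) ->
  size ws = r -> (mon 0 ws == a) = fits r a ws.
Proof.
move=> sa sz; apply/cmP/allP => [h i _|h i]; first by rewrite -h monE subn0.
rewrite monE subn0 /=; have [lt|le] := ltnP i r; last by rewrite sa // nth_default ?sz.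
by apply/eqP/h; rewrite mem_iota.
Qed.

Lemma malgMU (c d : R) (m1 m2 : {cmonom nat}) :
  << c *g m1 >> * << d *g m2 >> = << c * d *g mulcm m1 m2 >> :> {malg R[{cmonom nat}]}.
Proof. by rewrite malgM_def fgmulUU. Qed.

Lemma malgXU (d c : R) k w (m : {cmonom nat}) :
  << d *g ucm k >> ^+ w * << c *g m >> = << d ^+ w * c *g iter w (mulcm (ucm k)) m >>
  :> {malg R[{cmonom nat}]}.
Proof.
elim: w => [|w IH]; first by rewrite !expr0 !mul1r.
rewrite exprS -mulrA IH malgMU exprS mulrA; reflexivity.
Qed.

Lemma malgC_exp (c : R) w : (malgC c : {malg R[{cmonom nat}]}) ^+ w = << c ^+ w *g onecm nat >>.
Proof.
elim: w => [|w IH]; first exact: esym (@mpolyC1E {cmonom nat} R).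
rewrite exprS IH malgMU mul0cm exprS; reflexivity.
Qed.

Lemma malg_term (q d C : R) k w t (m : {cmonom nat}) :
  << d *g ucm k >> ^+ w * (malgC q : {malg R[{cmonom nat}]}) ^+ t * << C *g m >> =
  << d ^+ w * (q ^+ t * C) *g iter w (mulcm (ucm k)) m >>.
Proof.
rewrite -mulrA; etransitivity; last exact: malgXU.
congr (_ * _); rewrite malgC_exp malgMU mul0cm; reflexivity.
Qed.

(** The scalar d carries the factor q^(n-1) of the variables y; the variables x take d = 1. *)
Lemma hsum_expand (q d : R) r k mu la :
  hsum n M (malgC q : {malg R[{cmonom nat}]}) [seq << d *g ucm i >> | i <- iota k r] mu la =
  \sum_(c <- paths r | path hstrip mu c && (last mu c == la))
    << d ^+ sumn (weights mu c) * q ^+ total_spin mu c *g mon k (weights mu c) >>.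
Proof.
elim: r k mu => [|r IH] k mu.
  by rewrite /= big_cons big_nil /= !expr0 mulr1; case: eqP; rewrite ?addr0.
rewrite [LHS]/= [RHS]big_mkcond big_allpairs_dep /=; apply: eq_bigr => nu _.
rewrite IH -big_mkcond /hwt -/(hstrip mu nu) /=.
case: (hstrip mu nu); last by rewrite mul0r /= big_pred0.
rewrite mulr_sumr; apply: eq_bigr => c _.
etransitivity; first exact: malg_term.
congr mkmalgU.
have -> : d ^+ sumn (weights mu (nu :: c)) =
    d ^+ nribbons n mu nu * d ^+ sumn (weights nu c) := exprD _ _ _.
have -> : q ^+ total_spin mu (nu :: c) =
    q ^+ strip_spin n mu nu * q ^+ total_spin nu c := exprD _ _ _.
by rewrite -!mulrA; congr (_ * _); rewrite mulrCA.
Qed.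

Lemma hsum_coeff (q d : R) r mu la (a : {cmonom nat}) :
  (forall i, (r <= i)%N -> a i = 0%N) ->
  (hsum n M (malgC q : {malg R[{cmonom nat}]}) [seq << d *g ucm i >> | i <- iota 0 r] mu la)@_a =
  d ^+ weight_sum r a * tau q r mu la a.
Proof.
move=> sa; rewrite hsum_expand raddf_sum /= /tau mulr_sumr.
rewrite big_mkcond [RHS]big_mkcond; apply: eq_big_seq => c.
rewrite mem_paths => /andP[/eqP sz _]; rewrite andbA.
case: (path hstrip mu c && (last mu c == la)) => //=.
have szw : size (weights mu c) = r := etrans (size_pairmap _ _ _) sz.
rewrite mcoeffU (mon_fits sa szw); case: ifP => [f|_]; last by rewrite mulr0n.
by rewrite mulr1n (sumn_fits szw f).
Qed.

End Tau.
End Tableaux.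

(** * Coefficients in two sets of variables *)

Section Coefficients.
Variable R : comNzRingType.
Local Notation polyX := {malg R[{cmonom nat}]}.
Local Notation polyXY := {malg polyX[{cmonom nat}]}.

Lemma mcoeff_mul_ucm (B : comNzRingType) (g : {malg B[{cmonom nat}]}) (c : B) j (b : {cmonom nat}) :
  b j = 0%N -> (g * << c *g ucm j >>)@_b = 0.
Proof.
move=> bj; rewrite malgM_def fgmulgU raddf_sum big1 // => k _ /=.
rewrite mcoeffU; case: eqP => [e|_]; last by rewrite mulr0n.
by move: bj; rewrite -e cmM ucmE eqxx addn1.
Qed.

Lemma coefXY_mul_term (P : polyXY) (z : R) i j (a b : {cmonom nat}) :
  (a i == 0%N) || (b j == 0%N) -> coefXY (P * termXY z i j) a b = 0.
Proof.
rewrite /coefXY /termXY => /orP[/eqP ai|/eqP bj]; last by rewrite mcoeff_mul_ucm // mcoeff0.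
rewrite malgM_def fgmulgU !raddf_sum big1 // => k _ /=.
by rewrite mcoeffU raddfMn /= mcoeff_mul_ucm // mul0rn.
Qed.

Lemma coefXYD (P Q : polyXY) a b : coefXY (P + Q) a b = coefXY P a b + coefXY Q a b.
Proof. by rewrite /coefXY !mcoeffD. Qed.

Lemma coefXY_mul_factor (q : R) (P : polyXY) (m : nat) i j (a b : {cmonom nat}) :
  (a i == 0%N) || (b j == 0%N) ->
  coefXY (P * \prod_(k < m) (1 + termXY (q ^+ (2 * k)) i j)) a b = coefXY P a b.
Proof.
move=> z; elim: (index_enum _) P => [|k s IH] P; first by rewrite big_nil mulr1.
rewrite big_cons mulrA IH; set t := termXY _ i j.
have -> : P * (1 + t) = P + P * t.
  exact: etrans (mulrDr P 1 t) (congr1 (fun x => x + P * t) (mulr1 P)).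
rewrite coefXYD; exact: etrans (congr1 _ (coefXY_mul_term P _ z)) (addr0 _).
Qed.

Definition cmbound (a : {cmonom nat}) : nat := \max_(i <- finsupp (cmonom_val a)) i.+1.

Lemma cmboundP (a : {cmonom nat}) i : (cmbound a <= i)%N -> a i = 0%N.
Proof.
move=> le; apply/eqP; rewrite cmE_eq0; apply/negP => ia.
have := @leq_bigmax_seq _ (enum_fset (finsupp (cmonom_val a))) xpredT (fun i => i.+1) i ia isT.
by rewrite ltnNge le.
Qed.

(** A factor outside the r by r square is 1 plus multiples of x_i y_j, one of whose variables is
    absent from the monomial; such factors are dropped one by one. *)
Lemma coefXY_prod_stable (q : R) (m r : nat) (a b : {cmonom nat}) (B : {fset nat * nat}) :
  (cmbound a <= r)%N -> (cmbound b <= r)%N ->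
  ([fset ij in [seq (i, j) | i <- iota 0 r, j <- iota 0 r]] `<=` B)%fset ->
  coefXY (\prod_(ij <- B) \prod_(k < m) (1 + termXY (q ^+ (2 * k)) ij.1 ij.2)) a b =
  coefXY (\prod_(j <- iota 0 r) \prod_(i <- iota 0 r)
    \prod_(k < m) (1 + termXY (q ^+ (2 * k)) i j)) a b.
Proof.
move=> ra rb sub; pose F (ij : nat * nat) : polyXY := \prod_(k < m) (1 + termXY (q ^+ (2 * k)) ij.1 ij.2).
change (coefXY (\prod_(ij <- B) F ij) a b = coefXY (\prod_(j <- iota 0 r) \prod_(i <- iota 0 r) F (i, j)) a b).
set s := [seq (i, j) | i <- iota 0 r, j <- iota 0 r].
have us : uniq s by apply: allpairs_uniq; rewrite ?iota_uniq // => -[? ?] [? ?].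
have pe : perm_eq B (s ++ [seq ij <- B | ij \notin s]).
  apply: uniq_perm; first exact: fset_uniq.
    rewrite cat_uniq us filter_uniq ?fset_uniq // andbT /=; apply/hasPn => ij.
    by rewrite mem_filter => /andP[].
  move=> ij; rewrite mem_cat mem_filter; case: (boolP (ij \in s)) => //= ijs.
  by rewrite (fsubsetP sub) // in_fset /=.
transitivity (coefXY (\prod_(ij <- s) F ij) a b); last first.
  apply: (congr1 (fun p => coefXY p a b)); rewrite [RHS]exchange_big /s big_allpairs_dep; reflexivity.
rewrite (perm_big _ pe) big_cat; move: (\prod_(ij <- s) F ij) => P.
have : all (fun ij => ij \notin s) [seq ij <- B | ij \notin s] by exact: filter_all.
elim: [seq ij <- B | ij \notin s] P => [|ij s' IH] P /=.
  move=> _; rewrite big_nil (_ : P * 1 = P); [reflexivity|exact: mulr1].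
move=> /andP[nij al]; rewrite big_cons mulrA IH // /F; apply: coefXY_mul_factor.
apply: contraR nij; rewrite negb_or => /andP[ai bj].
apply/allpairsP; exists ij; rewrite !mem_iota /= add0n; case: ij ai bj => i j /= ai bj; split=> //.
  by rewrite ltnNge; apply: contra ai => le; apply/eqP/cmboundP/(leq_trans ra).
by rewrite ltnNge; apply: contra bj => le; apply/eqP/cmboundP/(leq_trans rb).
Qed.

(** Polynomials in Y have coefficients in the ring of polynomials in X, so the sum over x-chains is
    a constant and can be computed in the inner ring. *)
Lemma hsum_malgC (n M : nat) (q : polyX) xs mu la :
  hsum n M (malgC q : polyXY) [seq malgC x | x <- xs] mu la = malgC (hsum n M q xs mu la).
Proof.
elim: xs mu => [|x xs IH] mu /=.
  exact/esym/mpolyC_nat.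
rewrite raddf_sum /=; apply: eq_bigr => nu _; rewrite IH /hwt; case: ifP => _.
  by rewrite !mpolyCM !rmorphXn.
rewrite !mul0r malgC0E; reflexivity.
Qed.

Lemma tau_malgC n M (q : R) r mu la c :
  tau n M (malgC q : polyX) r mu la c = malgC (tau n M q r mu la c).
Proof.
rewrite /tau raddf_sum; apply: eq_bigr => d _; exact: malgC_exp.
Qed.
End Coefficients.

(** * Comparing coefficients of the two sides *)

Section Assembly.
Variable R : comNzRingType.
Local Notation polyX := {malg R[{cmonom nat}]}.
Local Notation polyXY := {malg polyX[{cmonom nat}]}.

Lemma termXY_mul (q : R) w i j :
  (malgC (<< 1 *g ucm i >> : polyX) : polyXY) * (<< 1 *g ucm j >> : polyXY) *
    (malgC (malgC q : polyX) : polyXY) ^+ w = termXY (q ^+ w) i j.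
Proof.
rewrite malgC_exp malgC_exp.
etransitivity.
  apply: (congr1 (fun x => x * _)); exact: malgMU.
etransitivity; first exact: malgMU.
rewrite /termXY mulcm0.
rewrite mul0cm.
apply: (congr1 (mkmalgU _)).
etransitivity.
  apply: (congr1 (fun x => x * _)); exact: mulr1.
etransitivity; first exact: malgMU.
by rewrite mulcm0 mul1r.
Qed.

Lemma coefXY_sum (I : Type) (s : seq I) (F : I -> polyXY) (a b : {cmonom nat}) :
  coefXY (\sum_(i <- s) F i) a b = \sum_(i <- s) coefXY (F i) a b.
Proof. by rewrite /coefXY !raddf_sum. Qed.

Lemma coefXY_hsum (p q : R) (de la : intpart) (n M : nat) (a b : {cmonom nat}) (r : nat) :
  (cmbound a <= r)%N -> (cmbound b <= r)%N ->
  coefXY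
    (hsum n M (malgC (malgC q : polyX) : polyXY)
       [seq (malgC x : polyXY) | x <- [seq (<< 1 *g ucm i >> : polyX) | i <- iota 0 r]]
       (conj_part de) (conj_part la) *
     hsum n M (malgC (malgC p : polyX) : polyXY)
       [seq y * (malgC (malgC q : polyX) : polyXY) ^+ n.-1 |
          y <- [seq (<< 1 *g ucm j >> : polyXY) | j <- iota 0 r]] de la) a b =
  q ^+ (n.-1 * weight_sum r b) *
     (tau n M q r (conj_part de) (conj_part la) a * tau n M p r de la b).
Proof.
move=> ra rb.
have eX := hsum_malgC n M (malgC q : polyX) [seq (<< 1 *g ucm i >> : polyX) | i <- iota 0 r]
  (conj_part de) (conj_part la).
have eys : [seq y * (malgC (malgC q : polyX) : polyXY) ^+ n.-1 |
          y <- [seq (<< 1 *g ucm j >> : polyXY) | j <- iota 0 r]] =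
      [seq << (malgC q : polyX) ^+ n.-1 *g ucm i >> | i <- iota 0 r].
  rewrite -map_comp; apply: eq_map => j; rewrite /= (malgC_exp (malgC q : polyX)).
  etransitivity; first exact: malgMU.
  by rewrite mulcm0; apply: (congr1 (mkmalgU _)); exact: mul1r.
have eY := @hsum_coeff n M _ (malgC p : polyX) ((malgC q : polyX) ^+ n.-1) r de la b
     (fun i le => cmboundP (leq_trans rb le)).
have eD : ((malgC q : polyX) ^+ n.-1) ^+ weight_sum r b = malgC (q ^+ (n.-1 * weight_sum r b)).
  exact: etrans (esym (exprM _ _ _)) (malgC_exp _ _).
rewrite eD tau_malgC in eY.
have {}eY := etrans eY (esym (mpolyCM _ _ _)).
have eX' := @hsum_coeff n M _ q 1 r (conj_part de) (conj_part la) a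
     (fun i le => cmboundP (leq_trans ra le)).
rewrite expr1n mul1r in eX'.
rewrite eys; etransitivity.
  apply: (congr1 (fun P => coefXY (P * _) a b)); exact: eX.
rewrite /coefXY mcoeffCM eY mulrC mcoeffCM eX' -mulrA; congr (_ * _); exact: mulrC.
Qed.

Lemma box_coeff (n : nat) (n_gt0 : (0 < n)%N) (p q : R) (de : intpart) (a b : {cmonom nat})
    (r M : nat) : p * q = 1 -> irreducible n de ->
  (cmbound a <= r)%N -> (cmbound b <= r)%N ->
  (head 0%N de + n * r.+1 <= M)%N -> (size de + n * r.+1 <= M)%N ->
  \sum_(la <- box_set M) q ^+ (n.-1 * weight_sum r b) *
     (tau n M q r (conj_part de) (conj_part la) a * tau n M p r de la b) =
  coefXY (\prod_(j <- iota 0 r) \prod_(i <- iota 0 r)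
    \prod_(k < n) (1 + termXY (q ^+ (2 * k)) i j)) a b.
Proof.
move=> pq1 irr ra rb le1 le2.
pose kap (c : R) : polyXY := malgC (malgC c : polyX).
have kapM c d : kap c * kap d = kap (c * d) by rewrite /kap -!mpolyCM.
have pq1' : kap p * kap q = 1.
  rewrite kapM pq1; exact: etrans (congr1 _ (mpolyC1E _ _)) (mpolyC1E _ _).
have leM : (n <= M)%N by lia.
pose xs : seq polyX := [seq << 1 *g ucm i >> | i <- iota 0 r].
pose ys : seq polyXY := [seq << 1 *g ucm j >> | j <- iota 0 r].
have := box_cauchy n_gt0 leM (xs := [seq malgC x | x <- xs]) (ys := ys) pq1' irr.
rewrite !size_map size_iota => /(_ le1 le2) main.
transitivity (coefXY (\sum_(la <- box_set M)
    hsum n M (kap q) [seq malgC x | x <- xs] (conj_part de) (conj_part la) *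
    hsum n M (kap p) [seq y * kap q ^+ n.-1 | y <- ys] de la) a b).
  rewrite coefXY_sum; apply: eq_bigr => la _.
  exact: esym (coefXY_hsum p q de la n M ra rb).
rewrite main; apply: (congr1 (fun P => coefXY P a b)).
rewrite big_map; apply: eq_bigr => j _; rewrite !big_map; apply: eq_bigr => i _.
apply: eq_bigr => k _; apply: (congr1 (+%R 1)); exact: termXY_mul.
Qed.
End Assembly.

Lemma ncore_summand (R : comNzRingType) (n : nat) (n_gt0 : (0 < n)%N) (p q : R)
    (de la : intpart) (a b : {cmonom nat}) (r M : nat) :
  ncore n la = de -> (cmbound a <= r)%N -> (cmbound b <= r)%N ->
  (#|` diagram de| + n * weight_sum r b <= M)%N ->
  (#|` diagram (conj_part de)| + n * weight_sum r a <= M)%N ->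
  q ^+ ((n - 1) * #|` skew_diagram la (ncore n la)| %/ n) *
    series_XY (ribbon_functionG n q (conj_part la)) (ribbon_functionG n p la) a b =
  q ^+ (n.-1 * weight_sum r b) *
    (tau n M q r (conj_part de) (conj_part la) a * tau n M p r de la b).
Proof.
move=> core ra rb leb lea; rewrite /series_XY /ribbon_functionG (ncore_conj n_gt0) core.
rewrite (ribbon_function_tau n_gt0 q _ (r := r) _ lea); last first.
  by move=> i le; apply: cmboundP; exact: leq_trans ra le.
rewrite (ribbon_function_tau n_gt0 p _ (r := r) _ leb); last first.
  by move=> i le; apply: cmboundP; exact: leq_trans rb le.
(* The size of [la] is tied to the weight b only if a chain exists; otherwise both sides vanish. *)
have [->|ne] := eqVneq (tau n M p r de la b) 0; first by rewrite !mulr0.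
congr (q ^+ _ * _); have cl := tau_card n_gt0 ne.
have -> : #|` skew_diagram la de| = (n * weight_sum r b)%N.
  have sub : (diagram de `<=` diagram la)%fset.
    move: ne core => _ <-; have [+ _] := ncore_spec n_gt0 la.
    elim=> [mu|al mu nu /removes_ribbonP-/(_ n_gt0)[i /addrib_sub h] _ IH] //.
    exact: fsubset_trans IH h.
  by rewrite /skew_diagram cardfsD (fsetIidPr sub) cl addKn.
by rewrite mulnCA mulKn // subn1.
Qed.

Theorem proposition36 (n : nat) (n_ge1 : (1 <= n)%N)
    (de : intpart) (de_core : is_ncore n de) :
  let q : {fraction {poly int}} := tofrac 'X in
  exists P : series2 {fraction {poly int}},
    is_series_prod
      (fun ij : nat * nat =>
         \prod_(k < n) (1 + termXY (q ^+ (2 * k)) ij.1 ij.2)) P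
    /\
    is_series_sum
      (fun la : intpart => ncore n la == de)
      (fun la a b =>
         q ^+ ((n - 1) * #|` skew_diagram la (ncore n la)| %/ n)
         * series_XY (ribbon_functionG n q (conj_part la))
                     (ribbon_functionG n q^-1 la) a b) P.
Proof.
move=> q.
have q0 : q != 0 by rewrite tofrac_eq0 polyX_eq0.
have irr := is_ncore_irreducible n_ge1 de_core.
pose bound (a b : {cmonom nat}) := maxn (cmbound a) (cmbound b).
exists (fun a b => coefXY (\prod_(j <- iota 0 (bound a b)) \prod_(i <- iota 0 (bound a b))
    \prod_(k < n) (1 + termXY (q ^+ (2 * k)) i j)) a b).
split=> a b; set r := bound a b; have ra : (cmbound a <= r)%N := leq_maxl _ _;
  have rb : (cmbound b <= r)%N := leq_maxr _ _.
  exists [fset ij in [seq (i, j) | i <- iota 0 r, j <- iota 0 r]]%fset => B sub.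
  exact: coefXY_prod_stable.
(* Large enough at once for the truncated identity and for all chains of weights a and b. *)
pose M := (head 0%N de + size de + n * r.+1 + #|` diagram de| + n * weight_sum r b +
  #|` diagram (conj_part de)| + n * weight_sum r a)%N.
have lea : (#|` diagram (conj_part de)| + n * weight_sum r a <= M)%N by rewrite /M; lia.
have leb : (#|` diagram de| + n * weight_sum r b <= M)%N by rewrite /M; lia.
have le1 : (head 0%N de + n * r.+1 <= M)%N by rewrite /M; lia.
have le2 : (size de + n * r.+1 <= M)%N by rewrite /M; lia.
exists (box_set M) => B sub.
rewrite -(box_coeff n_ge1 (mulVf q0) irr ra rb le1 le2) big_mkcond /=.
rewrite -(big_fset_incl _ sub) /=.
  apply: eq_bigr => la _; case: eqP => [core|core]; first exact: ncore_summand.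
  (* Chains preserve the core, so box partitions with another core contribute 0. *)
  have -> : tau n M q^-1 r de la b = 0; last by rewrite !mulr0.
  apply/eqP; apply: contraT => /(tau_ncore n_ge1) e; case: core.
  by rewrite e.
(* A nonzero contribution fixes the size of [la] at a value at most M, which would put [la] inside
   the box. *)
move=> la _ out; case: eqP => // core; rewrite (ncore_summand n_ge1 _ _ core ra rb leb lea).
have -> : tau n M q^-1 r de la b = 0; last by rewrite !mulr0.
apply/eqP; apply: contraT => /(tau_card n_ge1) card; case/negP: out.
rewrite mem_box_set; apply: box_sizes; apply: leq_trans leb; rewrite -card.
  exact: size_le_card_diagram.
exact: head_le_card_diagram.
Qed.
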